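(* The problem SATISFACTION for oblivious models corresponding to star influence games is solvable in polynomial time. That is, there is a polynomial time algorithm that, given a star influence game $\Gamma=(G,f,q,N)$ and an actor $i\in V(G)$, computes $\mathrm{Sat}_{\mathcal{M}^o(\Gamma)}(i)$.
   Context: Graphs are finite, directed, without loops or multiple edges; $P_G(i)=\{j\mid (j,i)\in E\}$. An influence graph is a pair $(G,f)$ with $G=(V,E)$ a digraph and $f$ assigning to each vertex a non-negative rational. For $X\subseteq V$, $n=|V|$: $F^0(X)=X$, $F^t(X)=F^{t-1}(X)\cup\{i\in V\mid |P_G(i)\cap F^{t-1}(X)|\ge f(i)\}$ for $1\le t\le n$, and $F(X)=F^n(X)$. An influence game is $\Gamma=(G,f,q,N)$ with $(G,f)$ an influence graph, $q$ an integer, $0\le q\le n$, and $N\subseteq V$. A star influence graph is an influence graph $(G,f)$ where $V(G)=\mathtt{L}\cup\mathtt{I}\cup\mathtt{R}\cup\{c\}\cup\mathtt{F}$ (pairwise disjoint sets; $c$ is the central vertex) and $E(G)=\{(u,c)\mid u\in\mathtt{L}\cup\mathtt{R}\}\cup\{(c,v)\mid v\in\mathtt{R}\cup\mathtt{F}\}$. A star influence game is an influence game $(G,f,q,N)$ where $(G,f)$ is a star influence graph and $N=\mathtt{L}\cup\mathtt{R}\cup\mathtt{I}$. The oblivious influence model $\mathcal{M}^o(\Gamma)$ (for $f$ positive, i.e. $f(i)>0$ for all $i$) has collective decision function $C(x)=1$ if $|F(X(x)\cap N)|\ge q$ and $C(x)=0$ otherwise, for $x\in\{0,1\}^n$, where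 $X(x)=\{i\mid x_i=1\}$. The satisfaction of actor $i$ is $\mathrm{Sat}(i)=|\{x\in\{0,1\}^n\mid C(x)=x_i\}|$. *)

(* Defs.v *)
From HB Require Import structures.
From mathcomp Require Import all_boot all_order all_algebra.

Set Implicit Arguments.
Unset Strict Implicit.
Unset Printing Implicit Defensive.

Import Order.TTheory GRing.Theory Num.Theory.

(** * Influence games *)

(* The arc (u, v) is [edge G u v]. *)
Record influence_graph (V : finType) := InfluenceGraph {
  edge : rel V;
  edge_irr : irreflexive edge;
  label : V -> rat;
  label_ge0 : forall i, (0 <= label i)%R
}.

Section Spread.
Variables (V : finType) (G : influence_graph V).

Definition preds (i : V) : {set V} := [set j | edge G j i].

Fixpoint spread_upto (t : nat) (X : {set V}) : {set V} :=
  if t is t'.+1 then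
    let Y := spread_upto t' X in
    Y :|: [set i | (label G i <= #|preds i :&: Y|%:R)%R]
  else X.

Definition spread (X : {set V}) : {set V} := spread_upto #|V| X.

Definition is_star (L I R : {set V}) (c : V) (F : {set V}) : Prop :=
  [/\ pairwise (fun A B : {set V} => [disjoint A & B])
        [:: L; I; R; [set c]; F],
      L :|: I :|: R :|: [set c] :|: F = [set: V]
    & forall u v, edge G u v =
        ((u \in L :|: R) && (v == c)) || ((u == c) && (v \in R :|: F))].

End Spread.

Record influence_game (V : finType) := InfluenceGame {
  graph :> influence_graph V;
  quota : nat;
  quota_le : quota <= #|V|;
  players : {set V}
}.

Definition star_influence_game (V : finType) (g : influence_game V) : Prop :=
  exists (L I R : {set V}) (c : V) (F : {set V}),
    is_star g L I R c F /\ players g = L :|: R :|: I.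

Definition positive_labels (V : finType) (G : influence_graph V) : Prop :=
  forall i, (0 < label G i)%R.

(* The oblivious model is only considered for games with positive labels. *)
Definition oblivious_decision (V : finType) (g : influence_game V)
    (x : {ffun V -> bool}) : bool :=
  quota g <= #|spread g ([set i | x i] :&: players g)|.

Definition satisfaction (V : finType) (C : {ffun V -> bool} -> bool)
    (i : V) : nat :=
  #|[set x : {ffun V -> bool} | C x == x i]|.

(** * Deterministic multitape Turing machines *)

Inductive move := Left | Stay | Right.

(* A machine has [tm_extra.+1] two-way infinite tapes.  A cell is blank
   ([None]), holds an input letter ([inl]), or holds one of finitely many
   auxiliary symbols ([inr]). *)
Record tm (A : finType) := TM {
  tm_state : finType;
  tm_start : tm_state;
  tm_final : pred tm_state;
  tm_aux : finType;
  tm_extra : nat;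
  tm_delta : tm_state -> {ffun 'I_tm_extra.+1 -> option (A + tm_aux)} ->
    tm_state * {ffun 'I_tm_extra.+1 -> option (A + tm_aux) * move}
}.

Section Machine.
Variables (A : finType) (M : tm A).

Definition cell : Type := option (A + tm_aux M).

(* [(l, r)]: [r] lists the cells from the head rightwards, [l] those to the
   left of the head, nearest first; cells beyond both lists are blank. *)
Definition tape : Type := seq cell * seq cell.

Definition read (t : tape) : cell := head None t.2.

Definition write (a : cell) (t : tape) : tape := (t.1, a :: behead t.2).

Definition move_head (m : move) (t : tape) : tape :=
  match m with
  | Left => (behead t.1, head None t.1 :: t.2)
  | Stay => t
  | Right => (head None t.2 :: t.1, behead t.2)
  end.

Definition config : Type :=
  tm_state M * {ffun 'I_(tm_extra M).+1 -> tape}.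

(* Final configurations are fixed points. *)
Definition step (k : config) : config :=
  if tm_final k.1 then k else
  let: (s, act) := tm_delta k.1 [ffun j => read (k.2 j)] in
  (s, [ffun j => move_head (act j).2 (write (act j).1 (k.2 j))]).

Definition word (w : seq A) : seq cell := [seq Some (inl a) | a <- w].

(* The input is on the first tape, with the head on its first letter. *)
Definition start_config (w : seq A) : config :=
  (tm_start M, [ffun j => if j == ord0 then ([::], word w) else ([::], [::])]).

(* The output starts at the head of the last tape and ends before the first
   blank. *)
Definition outputs_within (T : nat) (w v : seq A) : Prop :=
  let k := iter T step (start_config w) in
  tm_final k.1 /\
  exists r : seq cell, (k.2 ord_max).2 = word v ++ r /\ head None r = None.

End Machine.

(* A function on the instances satisfying the promise [P], computed in time
   polynomial in the length of the encoded instance. *)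
Definition polytime_computable (A : finType) (X Y : Type) (P : X -> Prop)
    (encX : X -> seq A) (encY : Y -> seq A) (f : X -> Y) : Prop :=
  exists (M : tm A) (p : {poly nat}), forall x, P x ->
    outputs_within M (p.[size (encX x)])%R (encX x) (encY (f x)).

(** * The problem SATISFACTION *)

(* The alphabet {0, 1, #}, where [None] is the separator #. *)
Definition letter : finType := option bool.

(* Binary notation, least significant digit first; 0 is the one-digit word. *)
Definition enc_nat (m : nat) : seq letter :=
  [seq Some (odd (m %/ 2 ^ k)) | k <- iota 0 (trunc_log 2 m).+1].

Definition enc_pred (n : nat) (B : pred 'I_n) : seq letter :=
  [seq Some (B j) | j <- enum 'I_n].

Definition delimited (s : seq letter) : seq letter := rcons s None.

(* Labels are non-negative, so that no sign is needed. *)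
Definition enc_rat (r : rat) : seq letter :=
  delimited (enc_nat `|numq r|) ++ delimited (enc_nat `|denq r|).

Record sat_instance := SatInstance {
  nvertices : nat;
  game : influence_game 'I_nvertices;
  actor : 'I_nvertices
}.

(* The adjacency matrix row by row, the labels in binary, the quota, the
   characteristic vector of the players and the index of the actor; the number
   of vertices is the length of the first row. *)
Definition enc_instance (x : sat_instance) : seq letter :=
  flatten [seq delimited (enc_pred (edge (game x) u)) | u <- enum 'I_(nvertices x)]
  ++ flatten [seq enc_rat (label (game x) u) | u <- enum 'I_(nvertices x)]
  ++ delimited (enc_nat (quota (game x)))
  ++ delimited (enc_pred (mem (players (game x))))
  ++ delimited (enc_nat (actor x)).

Definition oblivious_star (x : sat_instance) : Prop :=
  positive_labels (game x) /\ star_influence_game (game x).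

Definition oblivious_satisfaction (x : sat_instance) : nat :=
  satisfaction (oblivious_decision (game x)) (actor x).

(* Main.v *)
(* In a star whose labels are positive, the centre can only be activated by the
   initially active leaves, after which exactly the vertices of label at most 1
   adjacent from it follow.  Hence the decision on a profile depends only on three
   numbers: how many vertices are active among the non-easy leaves, among the easy
   ones (in R, of label at most 1), and among the isolated players.  Packing these
   numbers and the vote of the actor into the digits of one small number, the key
   of the profile, the number of profiles with key k is the coefficient of X^k in
   a product of binomials 1 + X^w, one per vertex; this product is computed with
   coefficients in binary, and the coefficients of the favourable keys are added.

   For the running time, a multitape machine simulates a structured program on
   finitely many stacks.  Storing trees in prefix notation on a stack makes the
   functions computable in polynomial time closed under composition, pairing,
   case analysis and under those folds over lists whose intermediate results have
   polynomial size, so that the algorithm can be written as a functional program. *)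

Require Import Defs.
From mathcomp Require Import all_boot all_order all_algebra.
From mathcomp Require Import zify.
From Stdlib Require Import FunctionalExtensionality.

Set Implicit Arguments.
Unset Strict Implicit.
Unset Printing Implicit Defensive.

Import Order.TTheory GRing.Theory Num.Theory.

(** * Stack programs and their compilation to Turing machines *)

(** Two kinds of numbers coexist. Numbers of vertices and keys stay polynomial, the keys below
    [2 * (n + 1) ^ 3] for [n] vertices, so unary notation and naive arithmetic suffice for them. The
    entries of the table can be exponential and the labels are arbitrary rationals, so these are
    lists of bits, which only need additions, comparisons and multiplication by a small unary
    factor.

    Polynomial time is established for a function defined on all words; the promise enters only in
    the correctness part. Hence every read has a default value, and the quota and the actor, given
    in binary, are capped before they become unary.

    The partition witnessing that the graph is a star is not part of the instance, so the role of a
    vertex has to be recovered from the arcs and the players. *)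

Definition state := nat -> seq letter.

Definition upd (s : state) i v : state := fun j => if j == i then v else s j.

Inductive prog :=
| Push of nat & letter
| Pop of nat
| Seq of prog & prog
| If of nat & pred (option letter) & prog & prog
| While of nat & pred (option letter) & prog.

(** The costs are the exact numbers of steps of the compiled machine: a push takes two, because the
    head must move left before writing, and every test takes one. *)
Inductive exec : prog -> state -> nat -> state -> Prop :=
| ExPush i a s : exec (Push i a) s 2 (upd s i (a :: s i))
| ExPop i s : exec (Pop i) s 1 (upd s i (behead (s i)))
| ExSeq p q s1 s2 s3 n m :
    exec p s1 n s2 -> exec q s2 m s3 -> exec (Seq p q) s1 (n + m) s3
| ExThen i (t : pred (option letter)) p q s s' n :
    t (ohead (s i)) -> exec p s n s' -> exec (If i t p q) s n.+1 s'
| ExElse i (t : pred (option letter)) p q s s' n :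
    ~~ t (ohead (s i)) -> exec q s n s' -> exec (If i t p q) s n.+1 s'
| ExStop i (t : pred (option letter)) p s : ~~ t (ohead (s i)) -> exec (While i t p) s 1 s
| ExLoop i (t : pred (option letter)) p s1 s2 s3 n m :
    t (ohead (s1 i)) -> exec p s1 n s2 -> exec (While i t p) s2 m s3 ->
    exec (While i t p) s1 (n + m).+1 s3.

Fixpoint width p :=
  match p with
  | Push i _ | Pop i => i.+1
  | Seq p q => maxn (width p) (width q)
  | If i _ p q => maxn i.+1 (maxn (width p) (width q))
  | While i _ p => maxn i.+1 (width p)
  end.

(** Program points form a finite type built along the syntax, so that they can be machine states.
    [None] is the test of a conditional or of a loop; a push has two points, [true] before the head
    has moved and [false] after. *)
Fixpoint ctl (p : prog) : finType :=
  match p with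
  | Push _ _ => bool
  | Pop _ => unit
  | Seq p q => (ctl p + ctl q)%type
  | If _ _ p q => option (ctl p + ctl q)
  | While _ _ p => option (ctl p)
  end.

Fixpoint entry p : ctl p :=
  match p with
  | Push _ _ => true
  | Pop _ => tt
  | Seq p _ => inl (entry p)
  | If _ _ _ _ => None
  | While _ _ _ => None
  end.

Inductive action := Nop | Back of nat | Put of nat & letter | Drop of nat.

(* [None] as next control state means that the program is finished. *)
Fixpoint next p : ctl p -> (nat -> option letter) -> option (ctl p) * action :=
  match p with
  | Push i a => fun x _ => if x then (Some false, Back i) else (None, Put i a)
  | Pop i => fun _ _ => (None, Drop i)
  | Seq p q => fun x r =>
      match x with
      | inl x => let: (y, a) := next x r in
                 (Some (oapp inl (inr (entry q)) y), a)
      | inr x => let: (y, a) := next x r in (omap inr y, a)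
      end
  | If i t p q => fun x r =>
      match x with
      | None =>
          (Some (Some (if t (r i) then inl (entry p) else inr (entry q))), Nop)
      | Some (inl x) => let: (y, a) := next x r in
                        (omap (fun z => Some (inl z)) y, a)
      | Some (inr x) => let: (y, a) := next x r in
                        (omap (fun z => Some (inr z)) y, a)
      end
  | While i t p => fun x r =>
      match x with
      | None => (if t (r i) then Some (Some (entry p)) else None, Nop)
      | Some x => let: (y, a) := next x r in (Some y, a)
      end
  end.

Definition tcell : Type := option (letter + void).

Definition letter_of (c : tcell) : option letter :=
  if c is Some (inl a) then Some a else None.

Definition act_at (a : action) (j : nat) (c : tcell) : tcell * move :=
  match a with
  | Nop => (c, Stay)
  | Back i => (c, if j == i then Left else Stay)
  | Put i b => (if j == i then Some (inl b) else c, Stay)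
  | Drop i => if j == i then (None, Right) else (c, Stay)
  end.

Section Compile.
Variable K : nat.

Definition machine (p : prog) : tm letter :=
  @TM letter (option (ctl p)) (Some (entry p)) (fun s => ~~ isSome s) void K
    (fun s r =>
       let: (y, a) := if s is Some x then next x (fun i => letter_of (r (inord i)))
                      else (None, Nop) in
       (y, [ffun j : 'I_K.+1 => act_at a j (r j)])).

Notation ttape := (seq tcell * seq tcell)%type.
Notation tapes := {ffun 'I_K.+1 -> ttape}.

Definition tread (t : ttape) : tcell := head None t.2.
Definition ttop (tp : tapes) i := letter_of (tread (tp (inord i))).

Definition tact (a : action) (t : ttape) (j : nat) : ttape :=
  let: (c, m) := act_at a j (tread t) in
  let t' := (t.1, c :: behead t.2) in
  match m with
  | Left => (behead t'.1, head None t'.1 :: t'.2)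
  | Stay => t'
  | Right => (head None t'.2 :: t'.1, behead t'.2)
  end.

Definition apply_act (a : action) (tp : tapes) : tapes :=
  [ffun j : 'I_K.+1 => tact a (tp j) j].

(** A run includes the step that leaves the program but no further step, so that runs of consecutive
    programs can be concatenated. *)
Inductive reach p : ctl p -> tapes -> nat -> tapes -> Prop :=
| ReachExit x tp a : next x (ttop tp) = (None, a) ->
    reach x tp 1 (apply_act a tp)
| ReachStep x y tp a n tp' : next x (ttop tp) = (Some y, a) ->
    reach y (apply_act a tp) n tp' -> reach x tp n.+1 tp'.

Lemma reach_seq_r p q (x : ctl q) tp n tp' :
  reach x tp n tp' -> @reach (Seq p q) (inr x) tp n tp'.
Proof.
elim=> {x tp n tp'} [x tp a e|x y tp a n tp' e _ IH].
  by apply: ReachExit; rewrite /= e.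
by apply: ReachStep IH; rewrite /= e.
Qed.

Lemma reach_seq p q (x : ctl p) tp n tp' m tp'' :
  reach x tp n tp' -> reach (entry q) tp' m tp'' ->
  @reach (Seq p q) (inl x) tp (n + m) tp''.
Proof.
elim=> {x tp n tp'} [x tp a e|x y tp a n tp' e _ IH] /= Hq.
  by rewrite add1n; apply: ReachStep (reach_seq_r _ Hq); rewrite /= e.
by rewrite addSn; apply: ReachStep (IH Hq); rewrite /= e.
Qed.

Lemma reach_then i t p q (x : ctl p) tp n tp' :
  reach x tp n tp' -> @reach (If i t p q) (Some (inl x)) tp n tp'.
Proof.
elim=> {x tp n tp'} [x tp a e|x y tp a n tp' e _ IH].
  by apply: ReachExit; rewrite /= e.
by apply: ReachStep IH; rewrite /= e.
Qed.

Lemma reach_else i t p q (x : ctl q) tp n tp' :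
  reach x tp n tp' -> @reach (If i t p q) (Some (inr x)) tp n tp'.
Proof.
elim=> {x tp n tp'} [x tp a e|x y tp a n tp' e _ IH].
  by apply: ReachExit; rewrite /= e.
by apply: ReachStep IH; rewrite /= e.
Qed.

Lemma reach_while i t p (x : ctl p) tp n tp' m tp'' :
  reach x tp n tp' -> @reach (While i t p) None tp' m tp'' ->
  @reach (While i t p) (Some x) tp (n + m) tp''.
Proof.
elim=> {x tp n tp'} [x tp a e|x y tp a n tp' e _ IH] /= Hw.
  by rewrite add1n; apply: ReachStep Hw; rewrite /= e.
by rewrite addSn; apply: ReachStep (IH Hw); rewrite /= e.
Qed.

(* A tape holds a stack from its head rightwards, surrounded by blanks. *)
Definition holds (t : ttape) (s : seq letter) :=
  (exists k, t.1 = nseq k None) /\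
  (exists k, t.2 = [seq Some (inl a) | a <- s] ++ nseq k None).

Definition rep (tp : tapes) (s : state) := forall j : 'I_K.+1, holds (tp j) (s j).

Lemma holds_top t s : holds t s -> letter_of (tread t) = ohead s.
Proof.
case=> _ [k]; rewrite /tread => ->.
by case: s => [|a s] //=; case: k.
Qed.

Lemma rep_top tp s i : rep tp s -> i < K.+1 -> ttop tp i = ohead (s i).
Proof.
by move=> h iK; rewrite /ttop (holds_top (h _)) inordK.
Qed.

(** Idle tapes are rewritten too: writing back the symbol read can make the blank under the head
    explicit, and the trailing blanks allowed by [holds] absorb it. *)
Lemma holds_same t s : holds t s -> holds (t.1, tread t :: behead t.2) s.
Proof.
case=> h [k e]; split=> //=; rewrite /tread e.
case: s {e} => [|a s] /=; last by exists k.
by case: k => [|k]; [exists 1 | exists k.+1].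
Qed.

Lemma tact_id a t j : act_at a j (tread t) = (tread t, Stay) ->
  tact a t j = (t.1, tread t :: behead t.2).
Proof. by rewrite /tact => ->. Qed.

Lemma rep_nop tp s : rep tp s -> rep (apply_act Nop tp) s.
Proof.
by move=> h j; rewrite ffunE tact_id //; apply: holds_same.
Qed.

Lemma rep_push tp s i a : rep tp s ->
  rep (apply_act (Put i a) (apply_act (Back i) tp)) (upd s i (a :: s i)).
Proof.
move=> h j; rewrite !ffunE /upd; case: eqP => [<-|/eqP/negPf ne].
  rewrite /tact /= eqxx /=.
  have [[k1 /= ->] [k2 /= ->]] := holds_same (h j); split=> /=.
    by case: k1 => [|k1]; [exists 0 | exists k1].
  by exists k2.
have hold1 : holds (tact (Back i) (tp j) j) (s j).
  by rewrite tact_id /= ?ne //; apply: holds_same.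
by rewrite tact_id /= ?ne //; apply: holds_same.
Qed.

Lemma rep_pop tp s i : rep tp s ->
  rep (apply_act (Drop i) tp) (upd s i (behead (s i))).
Proof.
move=> h j; rewrite !ffunE /upd; case: eqP => [<-|/eqP/negPf ne].
  rewrite /tact /= eqxx /=.
  have [[k1 /= ->] [k2 ->]] := h j; split=> /=; first by exists k1.+1.
  by case: (s j) => [|b u] /=; [exists k2.-1; case: k2 | exists k2].
by rewrite !tact_id /= ?ne //; apply: holds_same.
Qed.

Lemma exec_reach p s n s' : exec p s n s' -> width p <= K.+1 ->
  forall tp, rep tp s -> exists2 tp', rep tp' s' & reach (entry p) tp n tp'.
Proof.
elim=> {p s n s'} /=.
- move=> i a s _ tp h; exists (apply_act (Put i a) (apply_act (Back i) tp)).
    exact: rep_push.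
  by apply: (@ReachStep (Push i a) true false) => //; apply: ReachExit.
- move=> i s _ tp h; exists (apply_act (Drop i) tp); first exact: rep_pop.
  exact: (@ReachExit (Pop i)).
- move=> p q s1 s2 s3 n m _ IHp _ IHq; rewrite geq_max => /andP[wp wq] tp h.
  have [tp1 h1 r1] := IHp wp tp h; have [tp2 h2 r2] := IHq wq tp1 h1.
  by exists tp2 => //; apply: reach_seq r2.
- move=> i t p q s s' n ht _ IH; rewrite !geq_max => /and3P[wi wp _] tp h.
  have [tp1 h1 r1] := IH wp _ (rep_nop h); exists tp1 => //.
  by apply: ReachStep (reach_then i t q r1); rewrite /= (rep_top h) // ht.
- move=> i t p q s s' n ht _ IH; rewrite !geq_max => /and3P[wi _ wq] tp h.
  have [tp1 h1 r1] := IH wq _ (rep_nop h); exists tp1 => //.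
  apply: ReachStep (reach_else i t p r1).
  by rewrite /= (rep_top h) // (negPf ht).
- move=> i t p s ht; rewrite geq_max => /andP[wi wp] tp h.
  exists (apply_act Nop tp); first exact: rep_nop.
  by apply: (@ReachExit (While i t p)); rewrite /= (rep_top h) // (negPf ht).
- move=> i t p s1 s2 s3 n m ht _ IHp _ IHw w; move: (w).
  rewrite geq_max => /andP[wi wp] tp h.
  have [tp1 h1 r1] := IHp wp _ (rep_nop h); have [tp2 h2 r2] := IHw w tp1 h1.
  exists tp2 => //; apply: (@ReachStep (While i t p) None (Some (entry p))).
    by rewrite /= (rep_top h) // ht.
  exact: reach_while r2.
Qed.

Lemma step_machine p (x : ctl p) (tp : tapes) :
  @step letter (machine p) (Some x, tp) =
  let: (y, a) := next x (ttop tp) in (y, apply_act a tp).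
Proof.
rewrite /step /=.
have -> : (fun i => letter_of
    ([ffun j => @read letter (machine p) (tp j)] (inord i))) = ttop tp.
  by apply: functional_extensionality => i; rewrite ffunE.
case: (next x (ttop tp)) => y a; congr (_, _).
apply/ffunP => j; rewrite !ffunE /tact.
by case: act_at => c [].
Qed.

Lemma reach_iter p (x : ctl p) tp n tp' : reach x tp n tp' ->
  iter n (@step letter (machine p)) (Some x, tp) = (None, tp').
Proof.
elim=> {x tp n tp'} [x tp a e|x y tp a n tp' e _ IH].
  by rewrite /iter step_machine e.
by rewrite iterSr step_machine e.
Qed.

Lemma iter_final p T (tp : tapes) :
  iter T (@step letter (machine p)) (None, tp) = (None, tp).
Proof. by elim: T => //= T ->. Qed.

Definition stacks (L : seq (seq letter)) : state := nth [::] L.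

Lemma exec_outputs p n w v s' T : exec p (stacks [:: w]) n s' ->
  s' K = v -> width p <= K.+1 -> n <= T -> outputs_within (machine p) T w v.
Proof.
move=> ex <- wp nT; rewrite /outputs_within.
pose tp : tapes := (start_config (machine p) w).2.
have h : rep tp (stacks [:: w]).
  move=> j; rewrite /tp ffunE; case: (unliftP ord0 j) => [j' ->|->] /=.
    by rewrite /stacks /= nth_nil; split; exists 0.
  by split; exists 0 => //=; rewrite cats0.
have [tp' h' r] := exec_reach ex wp h.
have -> : start_config (machine p) w = (Some (entry p), tp) by [].
(* Final configurations are fixed points, so the steps left over up to [T] change nothing. *)
rewrite -(subnK nT) iterD (reach_iter r) iter_final; split=> //=.
have [_ [k e]] := h' ord_max; exists (nseq k None).
by split; [exact: e | case: (k)].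
Qed.

End Compile.

(** * Basic stack programs *)

Definition run p s n s' := exists2 m, m <= n & exec p s m s'.

Lemma run_le p s n m s' : run p s n s' -> n <= m -> run p s m s'.
Proof. by case=> k kn ex nm; exists k => //; apply: leq_trans nm. Qed.

Lemma run_seq p q s1 n s2 m s3 :
  run p s1 n s2 -> run q s2 m s3 -> run (Seq p q) s1 (n + m) s3.
Proof.
move=> [k kn ex] [l lm ey]; exists (k + l); first exact: leq_add.
exact: ExSeq ey.
Qed.

Lemma run_then i (t : pred (option letter)) p q s n s' :
  t (ohead (s i)) -> run p s n s' -> run (If i t p q) s n.+1 s'.
Proof. by move=> ht [k kn ex]; exists k.+1 => //; apply: ExThen. Qed.

Lemma run_else i (t : pred (option letter)) p q s n s' :
  ~~ t (ohead (s i)) -> run q s n s' -> run (If i t p q) s n.+1 s'.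
Proof. by move=> ht [k kn ex]; exists k.+1 => //; apply: ExElse. Qed.

Lemma run_stop i (t : pred (option letter)) p s :
  ~~ t (ohead (s i)) -> run (While i t p) s 1 s.
Proof. by move=> ht; exists 1 => //; apply: ExStop. Qed.

Lemma run_loop i (t : pred (option letter)) p s1 n s2 m s3 :
  t (ohead (s1 i)) -> run p s1 n s2 -> run (While i t p) s2 m s3 ->
  run (While i t p) s1 (n + m).+1 s3.
Proof.
move=> ht [k kn ex] [l lm ey]; exists (k + l).+1; first exact: leq_add.
exact: ExLoop ey.
Qed.

Lemma run_push i a s : run (Push i a) s 2 (upd s i (a :: s i)).
Proof. by exists 2 => //; apply: ExPush. Qed.

Lemma run_pop i s : run (Pop i) s 1 (upd s i (behead (s i))).
Proof. by exists 1 => //; apply: ExPop. Qed.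

(** A step adds at most one letter to a stack. Hence a time bound is also a bound on the size of the
    result, which is what makes composition polynomial. *)
Lemma run_size p s n s' i : run p s n s' -> size (s' i) <= size (s i) + n.
Proof.
case=> m mn ex; apply: (@leq_trans (size (s i) + m)); last by lia.
elim: ex => {p s m s' n mn} //=.
- by move=> j a s; rewrite /upd; case: eqP => [->|_] /=; lia.
- by move=> j s; rewrite /upd; case: eqP => [->|_]; rewrite ?size_behead; lia.
- by move=> *; lia.
- by move=> *; lia.
- by move=> *; lia.
- by move=> *; lia.
- by move=> *; lia.
Qed.

Ltac state_ext :=
  apply: functional_extensionality => ?; rewrite /upd;
  repeat (case: eqP => ? //=; subst=> //=).

(** A push carries a fixed letter, so copying the top of a stack takes one branch for each of the
    three letters. *)
Definition bylet i (f : letter -> prog) :=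
  If i (pred1 (Some (Some true))) (f (Some true))
    (If i (pred1 (Some (Some false))) (f (Some false)) (f None)).

Lemma run_bylet i f (s : state) a u n s' : s i = a :: u ->
  run (f a) s n s' -> run (bylet i f) s n.+2 s'.
Proof.
move=> e; rewrite /bylet; case: a e => [[]|] e h.
- by apply: run_then; [rewrite e | apply: run_le h _].
- by apply: run_else; [rewrite e | apply: run_then; [rewrite e|]].
- by apply: run_else; [rewrite e | apply: run_else; [rewrite e|]].
Qed.

Definition xfer i j := While i isSome (bylet i (fun a => Seq (Push j a) (Pop i))).

Definition xfer2 i j k :=
  While i isSome (bylet i (fun a => Seq (Push j a) (Seq (Push k a) (Pop i)))).

Definition clear i := While i isSome (Pop i).

Lemma run_xfer i j s : i != j ->
  run (xfer i j) s (6 * size (s i) + 1)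
    (upd (upd s i [::]) j (rev (s i) ++ s j)).
Proof.
move/eqP=> ij; move e: (s i) => u; elim: u s e => [|a u IH] s e.
  have -> : upd (upd s i [::]) j (rev [::] ++ s j) = s by state_ext.
  by apply: run_stop; rewrite e.
apply: run_le.
  apply: run_loop; [by rewrite e| |].
    apply: (run_bylet e); apply: run_seq; [exact: run_push|exact: run_pop].
  have e' : upd (upd s j (a :: s j)) i
      (behead (upd s j (a :: s j) i)) i = u.
    by rewrite /upd !eqxx; case: eqP => // _; rewrite e.
  have := IH _ e'.
  set s1 := upd (upd (upd _ _ _) _ _) _ _.
  have -> : s1 = upd (upd s i [::]) j (rev (a :: u) ++ s j); last exact.
  by rewrite rev_cons cat_rcons /s1; state_ext.
by rewrite /=; lia.
Qed.

Lemma run_xfer2 i j k s : uniq [:: i; j; k] ->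
  run (xfer2 i j k) s (8 * size (s i) + 1)
    (upd (upd (upd s i [::]) j (rev (s i) ++ s j)) k (rev (s i) ++ s k)).
Proof.
rewrite /= !inE negb_or -andbA => /and4P[/eqP ij /eqP ik /eqP jk _].
move e: (s i) => u; elim: u s e => [|a u IH] s e.
  rewrite (_ : upd _ _ _ = s); last by state_ext.
  by apply: run_stop; rewrite e.
apply: run_le.
  apply: run_loop; [by rewrite e| |].
    apply: (run_bylet e).
    apply: run_seq; [exact: run_push|apply: run_seq; [exact: run_push|exact: run_pop]].
  set s1 := upd (upd (upd _ _ _) _ _) _ _.
  have e' : s1 i = u.
    by rewrite /s1 /upd !eqxx; do 2![case: eqP => // _]; rewrite e.
  have := IH _ e'; set s2 := upd _ _ _.
  rewrite (_ : s2 = upd (upd (upd s i [::]) j (rev (a :: u) ++ s j)) k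
      (rev (a :: u) ++ s k)); first exact.
  by rewrite !rev_cons !cat_rcons /s2 /s1; state_ext.
by rewrite /=; lia.
Qed.

Lemma run_clear i s : run (clear i) s (2 * size (s i) + 1) (upd s i [::]).
Proof.
move e: (s i) => u; elim: u s e => [|a u IH] s e.
  rewrite (_ : upd _ _ _ = s); last by state_ext.
  by apply: run_stop; rewrite e.
apply: run_le.
  apply: run_loop; [by rewrite e|exact: run_pop|].
  have e' : upd s i (behead (s i)) i = u by rewrite /upd eqxx e.
  have := IH _ e'.
  by rewrite (_ : upd (upd _ _ _) _ _ = upd s i [::]); [exact|state_ext].
by rewrite /=; lia.
Qed.

Definition Skip := While 0 xpred0 (Pop 0).

Definition pushw i (u : seq letter) := foldr (fun a p => Seq p (Push i a)) Skip u.

Lemma run_pushw i u s : run (pushw i u) s (2 * size u + 1) (upd s i (u ++ s i)).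
Proof.
elim: u => [|a u IH] /=.
  rewrite (_ : upd _ _ _ = s); last by state_ext.
  exact: run_stop.
have := run_seq IH (run_push i a _).
rewrite (_ : upd (upd _ _ _) _ _ = upd s i ((a :: u) ++ s i)).
  by move=> h; apply: run_le h _ => /=; lia.
by rewrite /upd eqxx; state_ext.
Qed.

Lemma stacks_ext L L' : (forall i, nth [::] L i = nth [::] L' i) ->
  stacks L = stacks L'.
Proof. by move=> h; apply: functional_extensionality. Qed.

Lemma upd_stacks L i v : upd (stacks L) i v = stacks (set_nth [::] L i v).
Proof.
by apply: functional_extensionality => j; rewrite /upd /stacks nth_set_nth.
Qed.

(** * Running a program beside saved stacks *)

Fixpoint shift d p :=
  match p with
  | Push i a => Push (d + i) a
  | Pop i => Pop (d + i)
  | Seq p q => Seq (shift d p) (shift d q)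
  | If i t p q => If (d + i) t (shift d p) (shift d q)
  | While i t p => While (d + i) t (shift d p)
  end.

Definition above (A : seq (seq letter)) (s : state) : state :=
  fun j => if j < size A then nth [::] A j else s (j - size A).

Lemma above_at A s i : above A s (size A + i) = s i.
Proof. by rewrite /above ltnNge leq_addr addKn. Qed.

Lemma above_upd A s i v : above A (upd s i v) = upd (above A s) (size A + i) v.
Proof.
apply: functional_extensionality => j; rewrite /above /upd.
by case: ltnP => h; do !case: eqP => //; lia.
Qed.

Lemma above_stacks A L : above A (stacks L) = stacks (A ++ L).
Proof.
by apply: functional_extensionality => j; rewrite /above /stacks nth_cat.
Qed.

(** A frame rule: with its stacks renumbered, a program leaves the saved stacks [A] untouched, at
    the same cost. *)
Lemma exec_shift A p s n s' : exec p s n s' ->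
  exec (shift (size A) p) (above A s) n (above A s').
Proof.
elim=> {p s n s'} /=.
- by move=> i a s; rewrite above_upd -(above_at A s i); apply: ExPush.
- by move=> i s; rewrite above_upd -(above_at A s i); apply: ExPop.
- by move=> p q s1 s2 s3 n m _ h1 _ h2; apply: ExSeq h1 h2.
- by move=> i t p q s s' n ht _ h; apply: ExThen h; rewrite above_at.
- by move=> i t p q s s' n ht _ h; apply: ExElse h; rewrite above_at.
- by move=> i t p s ht; apply: ExStop; rewrite above_at.
- by move=> i t p s1 s2 s3 n m ht _ h1 _ h2; apply: ExLoop h1 h2; rewrite above_at.
Qed.

Lemma run_shift A p L n L' : run p (stacks L) n (stacks L') ->
  run (shift (size A) p) (stacks (A ++ L)) n (stacks (A ++ L')).
Proof.
by move=> [m mn ex]; exists m => //; rewrite -!above_stacks; apply: exec_shift.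
Qed.

Lemma srun_xfer i j L : i != j ->
  run (xfer i j) (stacks L) (6 * size (nth [::] L i) + 1)
    (stacks (set_nth [::] (set_nth [::] L i [::]) j
       (rev (nth [::] L i) ++ nth [::] L j))).
Proof. by move=> ij; rewrite -!upd_stacks; apply: (run_xfer (stacks L) ij). Qed.

Lemma srun_xfer2 i j k L : uniq [:: i; j; k] ->
  run (xfer2 i j k) (stacks L) (8 * size (nth [::] L i) + 1)
    (stacks (set_nth [::] (set_nth [::] (set_nth [::] L i [::]) j
       (rev (nth [::] L i) ++ nth [::] L j)) k
       (rev (nth [::] L i) ++ nth [::] L k))).
Proof. by move=> ijk; rewrite -!upd_stacks; apply: (run_xfer2 (stacks L) ijk). Qed.

Lemma srun_clear i L :
  run (clear i) (stacks L) (2 * size (nth [::] L i) + 1)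
    (stacks (set_nth [::] L i [::])).
Proof. by rewrite -!upd_stacks; apply: (run_clear i (stacks L)). Qed.

Lemma srun_push i a L :
  run (Push i a) (stacks L) 2 (stacks (set_nth [::] L i (a :: nth [::] L i))).
Proof. by rewrite -!upd_stacks; apply: (run_push i a (stacks L)). Qed.

Lemma srun_pop i L :
  run (Pop i) (stacks L) 1 (stacks (set_nth [::] L i (behead (nth [::] L i)))).
Proof. by rewrite -!upd_stacks; apply: (run_pop i (stacks L)). Qed.

Lemma srun_pushw i u L :
  run (pushw i u) (stacks L) (2 * size u + 1)
    (stacks (set_nth [::] L i (u ++ nth [::] L i))).
Proof. by rewrite -!upd_stacks; apply: (run_pushw i u (stacks L)). Qed.

(** * Trees in prefix notation *)

Inductive tree := Leaf | Node of tree & tree.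

Fixpoint ser t : seq letter :=
  if t is Node a b then Some true :: ser a ++ ser b else [:: Some false].

Definition scan i j k :=
  While k isSome
    (If i (pred1 (Some (Some true)))
       (Seq (Pop i) (Seq (Push j (Some true)) (Push k (Some true))))
       (Seq (Pop i) (Seq (Push j (Some false)) (Pop k)))).

(* Stack [k] counts in unary the subtrees that remain to be read. *)
Definition take_tree i j k := Seq (Push k (Some true)) (scan i j k).

(** The loop does not stop at the end of a subtree, so the statement takes the rest of the run as a
    continuation. At a node, the run on the right subtree is the continuation of the run on the left
    one. *)
Lemma run_scan i j k t : uniq [:: i; j; k] -> forall s r c u n s',
  s i = ser t ++ r -> s k = c :: u ->
  run (scan i j k) (upd (upd (upd s i r) j (rev (ser t) ++ s j)) k u) n s' ->
  run (scan i j k) s (8 * size (ser t) + n) s'.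
Proof.
rewrite /= !inE negb_or -andbA => /and4P[/eqP ij /eqP ik /eqP jk _].
elim: t => [|a IHa b IHb] s r c u n s' /= ei ek h.
  apply: run_le.
    apply: run_loop; [by rewrite ek| |exact: h].
    apply: run_else; first by rewrite ei.
    have := run_seq (run_pop i s) (run_seq (run_push j (Some false) _) (run_pop k _)).
    set s1 := upd (upd (upd _ _ _) _ _) _ _.
    rewrite (_ : s1 = upd (upd (upd s i r) j (Some false :: s j)) k u).
      exact.
    by rewrite /s1; state_ext; rewrite ?ei ?ek.
  by rewrite /=; lia.
set s1 := upd (upd (upd s i (ser a ++ ser b ++ r)) j (Some true :: s j)) k
  [:: Some true, c & u].
have ra : run (scan i j k) s1 (8 * size (ser a) + (8 * size (ser b) + n)) s'.
  apply: (IHa _ (ser b ++ r) (Some true) (c :: u)).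
  - by rewrite /s1 /upd; do 2![case: eqP => //]; rewrite eqxx.
  - by rewrite /s1 /upd eqxx.
  apply: (IHb _ r c u).
  - by rewrite /upd eqxx; do 2![case: eqP => //].
  - by rewrite /upd eqxx.
  move: h; set s2 := upd _ _ _; set s3 := upd _ _ _; rewrite (_ : s2 = s3) //.
  rewrite /s2 /s3 /s1 rev_cons rev_cat cat_rcons -catA; state_ext.
apply: run_le.
  apply: run_loop; [by rewrite ek| |exact: ra].
  apply: run_then; first by rewrite ei.
  have := run_seq (run_pop i s) (run_seq (run_push j (Some true) _)
    (run_push k (Some true) _)).
  set s2 := upd (upd (upd _ _ _) _ _) _ _.
  rewrite (_ : s2 = s1); first exact.
  by rewrite /s1 /s2; state_ext; rewrite ?ei ?ek //= -catA.
by rewrite /= size_cat; lia.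
Qed.

(** * Codes and polynomial bounds *)

Lemma srun_take_tree i j k L t r : uniq [:: i; j; k] ->
  nth [::] L i = ser t ++ r -> nth [::] L k = [::] ->
  run (take_tree i j k) (stacks L) (8 * size (ser t) + 3)
    (stacks (set_nth [::] (set_nth [::] L i r) j (rev (ser t) ++ nth [::] L j))).
Proof.
move=> u ei ek; have := u.
rewrite /= !inE negb_or -andbA => /and4P[/eqP ij /eqP ik /eqP jk _].
set s3 := stacks (set_nth _ _ _ _); set s1 := upd (stacks L) k [:: Some true].
apply: run_le.
  apply: run_seq; first exact: run_push.
  rewrite [X in upd _ _ (_ :: X)]ek -/s1.
  apply: (@run_scan i j k t u s1 r (Some true) [::]).
  - by rewrite /s1 /upd; case: eqP.
  - by rewrite /s1 /upd eqxx.
  set s2 := upd _ _ _.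
  rewrite (_ : s2 = s3); last first.
    rewrite /s3 -!upd_stacks /s2 /s1 /upd; apply: functional_extensionality => x.
    case: eqP => [->|_]; last by do !case: eqP => //.
    by do 2![case: eqP => [e|_]; first by case: jk + case: ik].
  apply: run_stop; rewrite /s3 -!upd_stacks /upd.
  case: eqP => [e|_]; first by case: jk.
  by case: eqP => [e|_]; [case: ik | rewrite /stacks ek].
by rewrite /=; lia.
Qed.

(** The codes are chosen so that many functions are the identity or a projection on trees: [false],
    [None], [0] and the empty list are all [Leaf], a nonempty list is coded as the pair of its head
    and its tail, and a number is a list of leaves. [ptime_recode] exploits these coincidences. *)
Class code (X : Type) := enc : X -> tree.

#[export] Instance code_tree : code tree := id.
#[export] Instance code_bool : code bool :=
  fun b => if b then Node Leaf Leaf else Leaf.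
#[export] Instance code_option X (cX : code X) : code (option X) :=
  fun o => if o is Some x then Node (enc x) Leaf else Leaf.
#[export] Instance code_prod X Y (cX : code X) (cY : code Y) : code (X * Y) :=
  fun p => Node (enc p.1) (enc p.2).
#[export] Instance code_seq X (cX : code X) : code (seq X) :=
  foldr (fun x t => Node (enc x) t) Leaf.
#[export] Instance code_nat : code nat := fun n => iter n (Node Leaf) Leaf.

Definition str X {cX : code X} (x : X) := ser (enc x).
Definition sz X {cX : code X} (x : X) := size (str x).

(** The base is at least 2, so that constants, sums and products are absorbed by increasing the
    exponent. *)
Definition pb E {cE : code E} (f : E -> nat) :=
  exists k, forall e, f e <= (sz e).+2 ^ k.

Section PolyBounds.
Variables (E : Type) (cE : code E).
Implicit Types f g : E -> nat.

Lemma pb_le g f : pb g -> (forall e, f e <= g e) -> pb f.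
Proof. by move=> [k h] fg; exists k => e; apply: leq_trans (h e). Qed.

Lemma pb_sz : pb (fun e : E => sz e).
Proof. by exists 1 => e; rewrite expn1; lia. Qed.

Lemma pb_const c : pb (fun _ : E => c).
Proof.
by exists c => e; apply/ltnW/ltn_expl.
Qed.

Lemma pb_mul f g : pb f -> pb g -> pb (fun e => f e * g e).
Proof. by move=> [a fa] [b gb]; exists (a + b) => e; rewrite expnD leq_mul. Qed.

Lemma pb_add f g : pb f -> pb g -> pb (fun e => f e + g e).
Proof.
move=> [a fa] [b gb]; exists (a + b).+1 => e.
apply: (leq_trans (leq_add (fa e) (gb e))).
set x := (sz e).+2; have x2 : 2 <= x by [].
have ha : x ^ a <= x ^ (a + b) by apply: leq_pexp2l => //; lia.
have hb : x ^ b <= x ^ (a + b) by apply: leq_pexp2l => //; lia.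
by rewrite expnS; nia.
Qed.

Lemma pb_exp f k : pb f -> pb (fun e => f e ^ k).
Proof.
move=> [a fa]; exists (a * k) => e; rewrite expnM.
by case: k => // k; rewrite leq_exp2r.
Qed.
End PolyBounds.

(** * Functions computed in polynomial time *)

Definition block := foldr Seq Skip.

Lemma run_block_nil s s' : s = s' -> run (block [::]) s 1 s'.
Proof. by move=> ->; apply: run_stop. Qed.

Lemma run_block p ps s1 n s2 m s3 :
  run p s1 n s2 -> run (block ps) s2 m s3 -> run (block (p :: ps)) s1 (n + m) s3.
Proof. exact: run_seq. Qed.

Lemma size_str X (cX : code X) (x : X) : size (str x) = sz x.
Proof. by []. Qed.

Ltac sizes := rewrite /= ?(size_cat, size_rev) /= ?(size_cat, size_rev) ?size_str;
  lia.

Ltac primitive := first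
  [ apply: srun_xfer; exact: isT | apply: srun_xfer2; exact: isT
  | apply: srun_clear | apply: srun_push | apply: srun_pop | apply: srun_pushw ].

Ltac steps := repeat (apply: run_block; [primitive | cbn [set_nth nth behead]]).

Ltac same_stacks := apply: stacks_ext; rewrite ?cats0 ?revK //;
  do 9?[case=> //=]; rewrite ?cats0 ?revK //;
  try (let i := fresh in intro i; rewrite ?nth_nil //).

Ltac finish := apply: run_block_nil; same_stacks.

Ltac halt := steps; finish.

(* A one-constructor type rather than a definition, so that a failing
   unification does not unfold it. *)
Variant ptime X Y {cX : code X} {cY : code Y} (f : X -> Y) : Prop :=
  Ptime of exists p T, pb T /\
    forall x, run p (stacks [:: str x]) (T x) (stacks [:: str (f x)]).

Section Closure.
Variables (E X Y : Type) (cE : code E) (cX : code X) (cY : code Y).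

Lemma ptime_ext (f g : E -> X) : f =1 g -> ptime f -> ptime g.
Proof.
move=> fg [[p [T [hT h]]]]; split; exists p, T; split=> // x; rewrite -fg; exact: h.
Qed.

Lemma ptime_recode (f : E -> X) (g : E -> Y) :
  (forall e, enc (f e) = enc (g e)) -> ptime f -> ptime g.
Proof.
move=> fg [[p [T [hT h]]]]; split; exists p, T; split=> // x.
by have := h x; rewrite /str fg.
Qed.

Lemma ptime_sz (f : E -> X) : ptime f -> pb (fun e => sz (f e)).
Proof.
move=> [[p [T [hT h]]]]; apply: (pb_le (pb_add (pb_sz cE) hT)) => e.
exact: (run_size 0 (h e)).
Qed.

Lemma pb_comp (f : E -> X) (g : X -> nat) : pb g -> ptime f ->
  pb (fun e => g (f e)).
Proof.
move=> [k gk] /ptime_sz pf.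
apply: (@pb_le _ _ (fun e => (sz (f e) + 2) ^ k)).
  by apply: pb_exp; apply: pb_add => //; apply: pb_const.
by move=> e; rewrite addn2.
Qed.

End Closure.

Ltac pbs := repeat first
  [ eassumption | apply: pb_const | apply: pb_sz | apply: pb_mul | apply: pb_add
  | apply: pb_exp | (apply: ptime_sz; eassumption) ].

Section Combinators.
Variables (E X Y : Type) (cE : code E) (cX : code X) (cY : code Y).

Lemma ptime_id : ptime (fun e : E => e).
Proof.
split; exists Skip, (fun _ => 1); split; first exact: pb_const.
by move=> e; apply: run_stop.
Qed.

Lemma ptime_const (c : X) : ptime (fun _ : E => c).
Proof.
split; exists (block [:: clear 0; pushw 0 (str c)]),
  (fun e => 2 * sz e + (2 * sz c + 10)); split.
  by pbs.
by move=> e; apply: run_le; [halt | sizes].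
Qed.

Lemma ptime_comp (g : X -> Y) (f : E -> X) :
  ptime g -> ptime f -> ptime (fun e => g (f e)).
Proof.
move=> [[p [T [hT h]]]] pf; have [[q [U [hU h']]]] := pf.
split; exists (Seq q p), (fun e => U e + T (f e)); split.
  by apply: pb_add => //; apply: pb_comp hT pf.
by move=> e; apply: run_seq (h' e) (h _).
Qed.

Lemma ptime_pair (f : E -> X) (g : E -> Y) :
  ptime f -> ptime g -> ptime (fun e => (f e, g e)).
Proof.
move=> pf pg; have [[p [T [hT h]]]] := pf; have [[q [U [hU h']]]] := pg.
(* A transfer reverses a stack, so the input is duplicated by a transfer followed by a double one.
   One copy waits on stack 0 while [p] consumes the other. The first result is then kept reversed,
   so that one transfer puts it in front of the second; a node letter completes the prefix code of
   the pair. *)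
split; exists (block [:: xfer 0 2; xfer2 2 0 1; shift 1 p; xfer 0 2; xfer 1 0; xfer 2 1;
  shift 1 q; xfer 0 1; Push 1 (Some true); xfer 1 2; xfer 2 0]),
  (fun e => T e + U e + 30 * (sz e + sz (f e) + sz (g e) + 1)); split.
  by pbs.
move=> e; apply: run_le.
  steps; rewrite !cats0 revK.
  apply: run_block.
    rewrite (_ : stacks _ = stacks ([:: str e] ++ [:: str e])).
      exact: (@run_shift [:: str e] p _ _ _ (h e)).
    by same_stacks.
  steps; rewrite !cats0 revK.
  apply: run_block.
    rewrite (_ : stacks _ = stacks ([:: rev (str (f e))] ++ [:: str e])).
      exact: (@run_shift [:: rev (str (f e))] q _ _ _ (h' e)).
    by same_stacks.
  halt.
by sizes.
Qed.

Lemma ptime_if (b : E -> bool) (f g : E -> X) :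
  ptime b -> ptime f -> ptime g -> ptime (fun e => if b e then f e else g e).
Proof.
move=> [[r [V [hV h'']]]] [[p [T [hT h]]]] [[q [U [hU h']]]].
split; exists (block [:: xfer 0 2; xfer2 2 0 1; shift 1 r;
   If 1 (pred1 (Some (Some true))) (Seq (clear 1) p) (Seq (clear 1) q)]),
  (fun e => T e + U e + V e + 30 * (sz e + 1)); split.
  by pbs.
move=> e; apply: run_le.
  steps; rewrite !cats0 revK.
  apply: run_block.
    rewrite (_ : stacks _ = stacks ([:: str e] ++ [:: str e])).
      exact: (@run_shift [:: str e] r _ _ _ (h'' e)).
    by same_stacks.
  apply: run_block; last exact: run_block_nil.
  have hc n r' s' : run r' (stacks [:: str e]) n s' ->
      run (Seq (clear 1) r') (stacks [:: str e; str (b e)]) (10 + n) s'.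
    move=> hr; apply: run_seq hr.
    have -> : stacks [:: str e] = stacks (set_nth [::] [:: str e; str (b e)] 1 [::]).
      by same_stacks.
    by apply: run_le (srun_clear _ _) _; rewrite /=; case: (b e).
  apply: (@run_le _ _ (10 + (T e + U e)).+1) => //.
  case: (b e) hc => hc; [apply: run_then => // | apply: run_else => //]; apply: hc.
    by apply: run_le (h e) _; lia.
  by apply: run_le (h' e) _; lia.
by sizes.
Qed.

End Combinators.

Arguments ptime_id {E cE}.
Arguments ptime_const {E X cE cX} c.

(** * Access to the parts of a tree *)

Definition tree_fst t := if t is Node a _ then a else Leaf.
Definition tree_snd t := if t is Node _ b then b else Leaf.
Definition is_leaf t := if t is Leaf then true else false.

Lemma ptime_tree_fst : ptime tree_fst.
Proof.
split; exists (If 0 (pred1 (Some (Some true)))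
  (block [:: Pop 0; take_tree 0 1 2; clear 0; xfer 1 0]) Skip),
  (fun t => 20 * (sz t + 1)); split; first by pbs.
case=> [|a b].
  by apply: (@run_le _ _ 2) => //; apply: run_else => //; apply: run_stop.
apply: run_le; first apply: run_then => //.
  steps; apply: run_block.
    by apply: (@srun_take_tree 0 1 2 _ a (ser b)).
  cbn [set_nth nth]; halt.
by rewrite /sz /str; sizes.
Qed.

Lemma ptime_tree_snd : ptime tree_snd.
Proof.
split; exists (If 0 (pred1 (Some (Some true)))
  (block [:: Pop 0; take_tree 0 1 2; clear 1]) Skip),
  (fun t => 20 * (sz t + 1)); split; first by pbs.
case=> [|a b].
  by apply: (@run_le _ _ 2) => //; apply: run_else => //; apply: run_stop.
apply: run_le; first apply: run_then => //.
  steps; apply: run_block.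
    by apply: (@srun_take_tree 0 1 2 _ a (ser b)).
  cbn [set_nth nth]; halt.
by rewrite /sz /str; sizes.
Qed.

Lemma ptime_is_leaf : ptime is_leaf.
Proof.
split; exists (If 0 (pred1 (Some (Some true)))
  (block [:: clear 0; pushw 0 (str false)]) (block [:: clear 0; pushw 0 (str true)])),
  (fun t => 20 * (sz t + 1)); split; first by pbs.
case=> [|a b].
  apply: run_le; first (apply: run_else => //; halt).
  by rewrite /sz /str; sizes.
apply: run_le; first (apply: run_then => //; halt).
by rewrite /sz /str; sizes.
Qed.

(** * Folds over lists *)

Section Fold.
Variables (E A X : Type) (cE : code E) (cA : code A) (cX : code X).
Variables (body : E -> A -> X -> A) (p : prog) (T : E * A * X -> nat).
Hypothesis run_p : forall e a x, run p (stacks [:: str (e, a, x)]) (T (e, a, x))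
  (stacks [:: str (body e a x)]).

(** Stacks 0, 1 and 2 hold the remaining list, the environment and the accumulator. The argument of
    the body is assembled on stack 3 from right to left, so the letters of its two nodes are pushed
    last. *)
Definition fold_step := block [:: Pop 0; take_tree 0 4 5; xfer 4 3; xfer 2 4;
  xfer 4 3; xfer 1 4; xfer2 4 1 3; Push 3 (Some true); Push 3 (Some true);
  shift 3 p; xfer 3 4; xfer 4 2].

Lemma run_fold_step e a x l :
  run fold_step (stacks [:: str (x :: l); str e; str a])
    (T (e, a, x) + 50 * (sz e + sz a + sz x + sz (body e a x) + 1))
    (stacks [:: str l; str e; str (body e a x)]).
Proof.
apply: run_le.
  apply: run_block; first exact: srun_pop.
  cbn [set_nth nth behead].
  apply: run_block.
    by apply: (@srun_take_tree 0 4 5 _ (enc x) (str l)).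
  cbn [set_nth nth]; rewrite cats0.
  steps; rewrite !revK !cats0.
  apply: run_block.
    rewrite (_ : stacks _ =
        stacks ([:: str l; str e; [::]] ++ [:: str (e, a, x)])).
      exact: (@run_shift [:: str l; str e; [::]] p _ _ _ (run_p e a x)).
    by same_stacks; rewrite /str /= -catA.
  halt.
by rewrite -!/(str x); sizes.
Qed.

Definition fold_loop := While 0 (pred1 (Some (Some true))) fold_step.

Lemma run_fold_loop e (M N : nat) l a : sz e <= M ->
  (forall k, sz (foldl (body e) a (take k l)) <= M) ->
  all (fun x => sz x <= M) l ->
  (forall a' x, sz a' <= M -> sz x <= M -> T (e, a', x) <= N) ->
  run fold_loop (stacks [:: str l; str e; str a])
    (size l * (N + 50 * (4 * M + 1) + 1) + 1)
    (stacks [:: str ([::] : seq X); str e; str (foldl (body e) a l)]).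
Proof.
move=> eM + + hN; elim: l a => [|x l IH] a hM /=; first by move=> _; apply: run_stop.
move=> /andP[xM lM].
have aM : sz a <= M by have := hM 0.
have aM' : sz (body e a x) <= M by have := hM 1; rewrite /= take0.
apply: run_le.
  apply: run_loop => //; first exact: run_fold_step.
  by apply: IH => // k; have := hM k.+1.
have := hN a x aM xM; set n := size l * _; rewrite mulSn -/n; lia.
Qed.

End Fold.

Lemma sz_cons X {cX : code X} x (l : seq X) : sz (x :: l) = (sz x + sz l).+1.
Proof. by rewrite /sz /str /= size_cat. Qed.

Lemma size_sz X {cX : code X} (l : seq X) : size l <= sz l.
Proof. by elim: l => // x l IH; rewrite sz_cons /=; lia. Qed.

Lemma sz_pair X Y {cX : code X} {cY : code Y} (x : X) (y : Y) :
  sz (x, y) = (sz x + sz y).+1.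
Proof. by rewrite /sz /str /= size_cat. Qed.

Lemma all_sz X {cX : code X} (l : seq X) : all (fun x => sz x <= sz l) l.
Proof.
elim: l => //= x l IH; rewrite sz_cons; apply/andP; split; first lia.
by apply: sub_all IH => y /=; lia.
Qed.

(** A polynomial-time body may double the accumulator at each round, so polynomial time of the body
    is not enough. The bound [B] is therefore required after every prefix of the list, and must be
    polynomial in the environment alone. *)
Lemma ptime_foldl E A X {cE : code E} {cA : code A} {cX : code X}
    (body : E -> A -> X -> A) (a : E -> A) (l : E -> seq X) (B : E -> nat) :
  ptime (fun p : E * A * X => body p.1.1 p.1.2 p.2) -> ptime a -> ptime l ->
  pb B -> (forall e k, sz (foldl (body e) (a e) (take k (l e))) <= B e) ->
  ptime (fun e => foldl (body e) (a e) (l e)).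
Proof.
move=> [[p [T [[d hT] h]]]] pa pl pB hB.
have hp e a' x : run p (stacks [:: str (e, a', x)]) (T (e, a', x))
  (stacks [:: str (body e a' x)]) by apply: h.
have [[q [U [hU hq]]]] := ptime_pair pl (ptime_pair (ptime_id) pa).
pose (M := fun e : E => B e + sz (l e) + sz e).
(* A triple of components of size at most [M e] has size at most [3 * M e + 2], and [pb] adds 2. The
   explicit power replaces [T], which need not be monotone in the size of its argument. *)
pose (N := fun e : E => (3 * M e + 4) ^ d).
split; exists (block [:: q; Pop 0; take_tree 0 4 5; Pop 0; take_tree 0 3 5;
  xfer 0 5; xfer 5 2; xfer 4 0; xfer 3 1; fold_loop p; Pop 0; clear 1; xfer 2 3;
  xfer 3 0]).
exists (fun e => U e + (sz (l e) * (N e + 50 * (4 * M e + 1) + 1) + 1)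
  + 100 * (M e + sz (a e) + 1)); split.
  by rewrite /N /M; pbs.
move=> e; apply: run_le.
  apply: run_block; first exact: hq.
  apply: run_block; first exact: srun_pop.
  cbn [set_nth nth behead].
  apply: run_block.
    by apply: (@srun_take_tree 0 4 5 _ (enc (l e)) (str (e, a e))).
  cbn [set_nth nth behead].
  apply: run_block; first exact: srun_pop.
  cbn [set_nth nth behead].
  apply: run_block.
    by apply: (@srun_take_tree 0 3 5 _ (enc e) (str (a e))).
  cbn [set_nth nth behead].
  steps; rewrite !cats0 !revK.
  apply: run_block.
    rewrite (_ : stacks _ = stacks [:: str (l e); str e; str (a e)]); last first.
      by same_stacks.
    apply: (@run_fold_loop _ _ _ _ _ _ body p T hp e (M e) (N e)).
    - by rewrite /M; lia.
    - by move=> k; apply: (leq_trans (hB e k)); rewrite /M; lia.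
    - by apply: sub_all (all_sz (l e)) => x /=; rewrite /M; lia.
    move=> a' x ha hx; apply: (leq_trans (hT _)); rewrite /N.
    case: d {hT N} => // d; rewrite leq_exp2r // !sz_pair; rewrite /M in ha hx *; lia.
  halt.
have ha : sz (foldl (body e) (a e) (l e)) <= M e.
  by have := hB e (size (l e)); rewrite take_size /M; lia.
have hl := size_sz (l e).
rewrite -!/(str _).
have : size (l e) * (N e + 50 * (4 * M e + 1) + 1) <=
  sz (l e) * (N e + 50 * (4 * M e + 1) + 1) by rewrite leq_mul2r hl orbT.
have : sz (l e) + sz e <= M e by rewrite /M; lia.
sizes.
Qed.

Lemma ptime_enc E X {cE : code E} {cX : code X} (f : E -> X) :
  ptime f -> ptime (fun e => enc (f e)).
Proof. exact: ptime_recode. Qed.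

Section Basics.
Context (E X Y : Type) {cE : code E} {cX : code X} {cY : code Y}.

Lemma ptime_fst (f : E -> X * Y) : ptime f -> ptime (fun e => (f e).1).
Proof.
by move=> /ptime_enc /(ptime_comp ptime_tree_fst); apply: ptime_recode.
Qed.

Lemma ptime_snd (f : E -> X * Y) : ptime f -> ptime (fun e => (f e).2).
Proof.
by move=> /ptime_enc /(ptime_comp ptime_tree_snd); apply: ptime_recode.
Qed.

Lemma ptime_cons (x : E -> X) (l : E -> seq X) :
  ptime x -> ptime l -> ptime (fun e => x e :: l e).
Proof. by move=> px pl; apply: ptime_recode (ptime_pair px pl). Qed.

Lemma ptime_nilp (l : E -> seq X) : ptime l -> ptime (fun e => nilp (l e)).
Proof.
move=> /ptime_enc /(ptime_comp ptime_is_leaf); apply: ptime_recode => e.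
by case: (l e).
Qed.

Lemma ptime_behead (l : E -> seq X) : ptime l -> ptime (fun e => behead (l e)).
Proof.
move=> /ptime_enc /(ptime_comp ptime_tree_snd); apply: ptime_recode => e.
by case: (l e).
Qed.

Lemma ptime_head (x : E -> X) (l : E -> seq X) :
  ptime x -> ptime l -> ptime (fun e => head (x e) (l e)).
Proof.
move=> /ptime_enc px pl.
have := ptime_if (ptime_nilp pl) px (ptime_comp ptime_tree_fst (ptime_enc pl)).
by apply: (ptime_recode (g := fun e => head (x e) (l e))) => e; case: (l e).
Qed.

Lemma ptime_isSome (f : E -> option X) : ptime f -> ptime (fun e => isSome (f e)).
Proof.
move=> /ptime_enc /(ptime_comp ptime_is_leaf) pf.
have := ptime_if pf (ptime_const (cX := code_bool) false) (ptime_const true).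
by apply: ptime_recode => e; case: (f e).
Qed.

Lemma ptime_odflt (x : E -> X) (f : E -> option X) :
  ptime x -> ptime f -> ptime (fun e => odflt (x e) (f e)).
Proof.
move=> /ptime_enc px /ptime_enc pf.
have := ptime_if (ptime_comp ptime_is_leaf pf) px (ptime_comp ptime_tree_fst pf).
by apply: ptime_recode => e; case: (f e).
Qed.

End Basics.

Section Booleans.
Context (E : Type) {cE : code E}.
Implicit Types f g : E -> bool.

Lemma ptime_negb f : ptime f -> ptime (fun e => ~~ f e).
Proof.
move=> pf; apply: (ptime_ext _ (ptime_if pf (ptime_const false)
  (ptime_const true))).
by move=> e; case: (f e).
Qed.

Lemma ptime_andb f g : ptime f -> ptime g -> ptime (fun e => f e && g e).
Proof. by move=> pf pg; apply: (ptime_if pf pg (ptime_const false)). Qed.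

Lemma ptime_orb f g : ptime f -> ptime g -> ptime (fun e => f e || g e).
Proof. by move=> pf pg; apply: (ptime_if pf (ptime_const true) pg). Qed.

Lemma ptime_eqb f g : ptime f -> ptime g -> ptime (fun e => f e == g e).
Proof.
move=> pf pg; apply: (ptime_ext _ (ptime_if pf pg (ptime_negb pg))) => e.
by case: (f e); case: (g e).
Qed.

Lemma ptime_addb f g : ptime f -> ptime g -> ptime (fun e => f e (+) g e).
Proof.
move=> pf pg; apply: (ptime_ext _ (ptime_if pf (ptime_negb pg) pg)) => e.
by case: (f e); case: (g e).
Qed.

Lemma ptime_nat_of_bool f : ptime f -> ptime (fun e => f e : nat).
Proof.
move=> pf; apply: (ptime_ext _ (ptime_if pf (ptime_const 1)
  (ptime_const 0))).
by move=> e; case: (f e).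
Qed.
End Booleans.

Section Lists.
Context (E A X Y : Type) {cE : code E} {cA : code A} {cX : code X} {cY : code Y}.

Lemma sz_nat (n : nat) : sz n = n.*2.+1.
Proof. by elim: n => // n IH; rewrite -[RHS]/(n.*2.+1.+2) -IH. Qed.

Lemma sz_cat (s t : seq X) : (sz (s ++ t)).+1 = sz s + sz t.
Proof. by elim: s => //= x s IH; rewrite !sz_cons; lia. Qed.

Lemma sz_rev (s : seq X) : sz (rev s) = sz s.
Proof.
elim: s => //= x s IH; rewrite rev_cons -cats1; have := sz_cat (rev s) [:: x].
by rewrite !sz_cons IH /sz /=; lia.
Qed.

Lemma sz_take k (s : seq X) : sz (take k s) <= sz s.
Proof.
have := sz_cat (take k s) (drop k s); rewrite cat_take_drop.
have : 0 < sz (drop k s) by case: (drop k s). lia.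
Qed.

Lemma sz_drop k (s : seq X) : sz (drop k s) <= sz s.
Proof.
have := sz_cat (take k s) (drop k s); rewrite cat_take_drop.
have : 0 < sz (take k s) by case: (take k s). lia.
Qed.

Lemma sz_all M (s : seq X) : all (fun x => sz x <= M) s -> sz s <= size s * M.+1 + 1.
Proof. by elim: s => //= x s IH /andP[hx /IH]; rewrite sz_cons; lia. Qed.

Lemma foldl_cons_rev (s : seq X) : foldl (fun a x => x :: a) [::] s = rev s.
Proof. by rewrite /rev; elim: s [::] => /=. Qed.

Lemma ptime_rev (l : E -> seq X) : ptime l -> ptime (fun e => rev (l e)).
Proof.
move=> pl; apply: (@ptime_ext _ _ _ _ (fun e => foldl (fun a x => x :: a) [::] (l e))).
  by move=> e; rewrite foldl_cons_rev.
apply: (@ptime_foldl _ _ _ _ _ _ (fun _ a x => x :: a) _ _ (fun e => sz (l e))).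
- apply: ptime_cons; first exact/ptime_snd/ptime_id.
  exact/ptime_snd/ptime_fst/ptime_id.
- exact: ptime_const.
- by [].
- exact: ptime_sz.
by move=> e k; rewrite foldl_cons_rev sz_rev sz_take.
Qed.

Lemma ptime_foldr (body : E -> X -> A -> A) (a : E -> A) (l : E -> seq X)
    (B : E -> nat) :
  ptime (fun p : E * X * A => body p.1.1 p.1.2 p.2) -> ptime a -> ptime l ->
  pb B -> (forall e k, sz (foldr (body e) (a e) (drop k (l e))) <= B e) ->
  ptime (fun e => foldr (body e) (a e) (l e)).
Proof.
move=> pbody pa pl pB hB.
apply: (@ptime_ext _ _ _ _
  (fun e => foldl (fun z x => body e x z) (a e) (rev (l e)))).
  by move=> e; rewrite foldl_rev.
apply: (@ptime_foldl _ _ _ _ _ _ (fun e z x => body e x z) _ _ B) => //.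
- apply: (ptime_comp pbody (f := fun p : E * A * X => (p.1.1, p.2, p.1.2))).
  apply: ptime_pair; last exact/ptime_snd/ptime_fst/ptime_id.
  apply: ptime_pair; last exact/ptime_snd/ptime_id.
  exact/ptime_fst/ptime_fst/ptime_id.
- exact: ptime_rev.
by move=> e k; rewrite take_rev foldl_rev.
Qed.

End Lists.

(** * Lists and unary numbers *)

Ltac ptime_more := fail.

(* [apply] unifies up to conversion ([ptime_fst] matches [divn], [ptime_cons] matches
   [iota 0 n.+1]), so the lemmas in [ptime_more] must be tried first. *)
Ltac ptime_auto := repeat first
  [ assumption | exact: ptime_const | exact: ptime_id | ptime_more | apply: ptime_fst
  | apply: ptime_snd | apply: ptime_pair | apply: ptime_cons | apply: ptime_nilp
  | apply: ptime_behead | apply: ptime_head | apply: ptime_isSome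
  | apply: ptime_odflt | apply: ptime_negb | apply: ptime_andb | apply: ptime_orb
  | apply: ptime_eqb | apply: ptime_addb | apply: ptime_rev | apply: ptime_if ].

Section ListFunctions.
Context (E A X Y : Type) {cE : code E} {cA : code A} {cX : code X} {cY : code Y}.

Lemma foldl_map_rev (f : X -> Y) (s : seq X) :
  foldl (fun a x => f x :: a) [::] s = rev [seq f x | x <- s].
Proof. by rewrite /rev; elim: s [::] => /=. Qed.

Lemma ptime_map (f : E -> X -> Y) (l : E -> seq X) :
  ptime (fun p : E * X => f p.1 p.2) -> ptime l ->
  ptime (fun e => [seq f e x | x <- l e]).
Proof.
move=> pf pl; have [d hd] := ptime_sz pf.
apply: (@ptime_ext _ _ _ _
  (fun e => rev (foldl (fun a x => f e x :: a) [::] (l e)))).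
  by move=> e; rewrite foldl_map_rev revK.
apply: ptime_rev.
(* [Q e] bounds the size of every image: the pair of [e] and an element costs one letter more than
   its components, and [pb] adds 2. *)
pose (Q := fun e => (sz e + sz (l e) + 3) ^ d).
apply: (@ptime_foldl _ _ _ _ _ _ (fun e a x => f e x :: a) _ _
  (fun e => sz (l e) * (Q e + 1) + 1)) => //.
- apply: ptime_cons; last by ptime_auto.
  apply: (ptime_comp pf (f := fun p : E * seq Y * X => (p.1.1, p.2))).
  by ptime_auto.
- by ptime_auto.
- by have := ptime_sz pl; rewrite /Q => ?; pbs.
move=> e k; set s := take k _.
rewrite foldl_map_rev sz_rev; apply: (@leq_trans (size s * (Q e).+1 + 1)).
  rewrite -(size_map (f e)); apply: sz_all; rewrite all_map.
  have h : all (fun x => sz x <= sz (l e)) s.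
    have := all_sz (cX := cX) (l e); rewrite /s; move: (sz (l e)) => M.
    elim: (l e) (k) => [|x u IH] [|j] //= /andP[hx hu].
    by rewrite hx IH.
  apply: sub_all h => x /= hx; apply: (leq_trans (hd (e, x))); rewrite /Q.
  by case: (d) => // d'; rewrite leq_exp2r // sz_pair; lia.
have h : size s <= sz (l e).
  by apply: leq_trans (sz_take k _); apply: size_sz.
by rewrite leq_add2r (addn1 (Q e)) leq_mul2r h orbT.
Qed.

Lemma ptime_succ (n : E -> nat) : ptime n -> ptime (fun e => (n e).+1).
Proof. by move/(ptime_pair (ptime_const Leaf)); apply: ptime_recode. Qed.

Lemma ptime_pred (n : E -> nat) : ptime n -> ptime (fun e => (n e).-1).
Proof.
move=> /ptime_enc /(ptime_comp ptime_tree_snd); apply: ptime_recode => e.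
by case: (n e).
Qed.

Lemma ptime_nat_eq0 (n : E -> nat) : ptime n -> ptime (fun e => n e == 0).
Proof.
move=> /ptime_enc /(ptime_comp ptime_is_leaf); apply: ptime_recode => e.
by case: (n e).
Qed.

(** Since a unary number and a list of [false] have the same code, iteration is a fold over a list
    obtained at no cost. *)
Lemma enc_nseq n : enc (nseq n false) = enc n.
Proof. by elim: n => //= n IH; rewrite -[enc n.+1]/(Node Leaf (enc n)) -IH. Qed.

Lemma iter_nseq (f : A -> A) a n :
  iter n f a = foldl (fun a (_ : bool) => f a) a (nseq n false).
Proof. by elim: n a => // n IH a; rewrite iterSr IH. Qed.

Lemma ptime_nseq (n : E -> nat) : ptime n -> ptime (fun e => nseq (n e) false).
Proof. by apply: ptime_recode => e; rewrite enc_nseq. Qed.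

Lemma ptime_iter (f : E -> A -> A) (a : E -> A) (n : E -> nat) (B : E -> nat) :
  ptime (fun p : E * A => f p.1 p.2) -> ptime a -> ptime n -> pb B ->
  (forall e k, k <= n e -> sz (iter k (f e) (a e)) <= B e) ->
  ptime (fun e => iter (n e) (f e) (a e)).
Proof.
move=> pf pa pn pB hB.
apply: (@ptime_ext _ _ _ _
  (fun e => foldl (fun a (_ : bool) => f e a) (a e) (nseq (n e) false))).
  by move=> e; rewrite iter_nseq.
apply: (@ptime_foldl _ _ _ _ _ _ (fun e a _ => f e a) _ _ B) => //.
- exact: (ptime_comp pf (ptime_fst (ptime_id))).
- exact: ptime_nseq.
move=> e k; have -> : take k (nseq (n e) false) = nseq (minn k (n e)) false.
  by elim: k (n e) => [|k IH] [|m] //=; rewrite IH minnSS.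
by rewrite -iter_nseq; apply/hB/geq_minr.
Qed.

End ListFunctions.

(** Numbers are unary, so the size of the code bounds the value itself. Most of the bounds required
    by folds come from here. *)
Lemma ptime_pb E {cE : code E} (n : E -> nat) : ptime n -> pb n.
Proof. by move=> /ptime_sz /pb_le; apply=> e; rewrite sz_nat; lia. Qed.

Lemma ptime_addn E {cE : code E} (m n : E -> nat) :
  ptime m -> ptime n -> ptime (fun e => m e + n e).
Proof.
move=> pm pn; apply: (@ptime_ext _ _ _ _ (fun e => iter (m e) succn (n e))).
  by move=> e; rewrite iter_succn addnC.
have := ptime_pb pm; have := ptime_pb pn => hn hm.
apply: (@ptime_iter _ _ _ _ _ _ _ (fun e => 2 * (m e + n e) + 1)) => //.
- by apply: ptime_succ; ptime_auto.
- by pbs.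
by move=> e k hk; rewrite iter_succn sz_nat; lia.
Qed.

Lemma ptime_subn E {cE : code E} (m n : E -> nat) :
  ptime m -> ptime n -> ptime (fun e => m e - n e).
Proof.
move=> pm pn; apply: (@ptime_ext _ _ _ _ (fun e => iter (n e) predn (m e))).
  by move=> e; rewrite iter_predn.
have := ptime_pb pm => hm.
apply: (@ptime_iter _ _ _ _ _ _ _ (fun e => 2 * m e + 1)) => //.
- by apply: ptime_pred; ptime_auto.
- by pbs.
by move=> e k hk; rewrite iter_predn sz_nat; lia.
Qed.

Lemma ptime_muln E {cE : code E} (m n : E -> nat) :
  ptime m -> ptime n -> ptime (fun e => m e * n e).
Proof.
move=> pm pn.
apply: (@ptime_ext _ _ _ _ (fun e => iter (m e) (addn (n e)) 0)).
  by move=> e; rewrite iter_addn_0 mulnC.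
have := ptime_pb pm; have := ptime_pb pn => hn hm.
apply: (@ptime_iter _ _ _ _ _ _ _ (fun e => 2 * (m e * n e) + 1)) => //.
- by apply: ptime_addn; last ptime_auto; apply: (ptime_comp pn); ptime_auto.
- exact: ptime_const.
- by pbs.
by move=> e k hk; rewrite iter_addn_0 sz_nat; nia.
Qed.

Lemma ptime_leq E {cE : code E} (m n : E -> nat) :
  ptime m -> ptime n -> ptime (fun e => m e <= n e).
Proof. by move=> pm pn; apply: ptime_nat_eq0; apply: ptime_subn. Qed.

Lemma ptime_eqn E {cE : code E} (m n : E -> nat) :
  ptime m -> ptime n -> ptime (fun e => m e == n e).
Proof.
move=> pm pn.
apply: (ptime_ext _ (ptime_andb (ptime_leq pm pn) (ptime_leq pn pm))) => e.
by rewrite eqn_leq.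
Qed.

Lemma ptime_maxn E {cE : code E} (m n : E -> nat) :
  ptime m -> ptime n -> ptime (fun e => maxn (m e) (n e)).
Proof.
by move=> pm pn; apply: (ptime_if (ptime_leq (ptime_succ pm) pn) pn pm).
Qed.

Lemma ptime_minn E {cE : code E} (m n : E -> nat) :
  ptime m -> ptime n -> ptime (fun e => minn (m e) (n e)).
Proof.
by move=> pm pn; apply: (ptime_if (ptime_leq (ptime_succ pm) pn) pm pn).
Qed.

Lemma ptime_sumn E {cE : code E} (l : E -> seq nat) :
  ptime l -> ptime (fun e => sumn (l e)).
Proof.
move=> pl; have := ptime_sz pl => hl.
apply: (@ptime_foldr _ _ _ _ _ _ (fun _ => addn) _ _ (fun e => 2 * sz (l e) + 1)) => //.
- by apply: ptime_addn; ptime_auto.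
- exact: ptime_const.
- by pbs.
move=> e k; apply: (@leq_trans (2 * sz (drop k (l e)) + 1)); last first.
  by rewrite leq_add2r leq_mul2l; exact: sz_drop.
elim: (drop _ _) => // x s; rewrite sz_cons !sz_nat /=; lia.
Qed.

Lemma ptime_size E X {cE : code E} {cX : code X} (l : E -> seq X) :
  ptime l -> ptime (fun e => size (l e)).
Proof.
move=> pl; apply: (@ptime_ext _ _ _ _ (fun e => sumn [seq 1 | _ <- l e])).
  by move=> e; elim: (l e) => //= x s ->.
by apply: ptime_sumn; apply: ptime_map => //; apply: ptime_const.
Qed.

Lemma ptime_count E X {cE : code E} {cX : code X} (P : E -> X -> bool) (l : E -> seq X) :
  ptime (fun p : E * X => P p.1 p.2) -> ptime l ->
  ptime (fun e => count (P e) (l e)).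
Proof.
move=> pP pl.
apply: (@ptime_ext _ _ _ _ (fun e => sumn [seq nat_of_bool (P e x) | x <- l e])).
  by move=> e; rewrite sumn_count.
by apply: ptime_sumn; apply: ptime_map => //; apply: ptime_nat_of_bool.
Qed.

Lemma ptime_has E X {cE : code E} {cX : code X} (P : E -> X -> bool) (l : E -> seq X) :
  ptime (fun p : E * X => P p.1 p.2) -> ptime l ->
  ptime (fun e => has (P e) (l e)).
Proof.
move=> pP pl; apply: (@ptime_ext _ _ _ _ (fun e => ~~ (count (P e) (l e) == 0))).
  by move=> e; rewrite has_count lt0n.
by apply/ptime_negb/ptime_nat_eq0/ptime_count.
Qed.

Lemma ptime_nth E X {cE : code E} {cX : code X} (x : E -> X) (l : E -> seq X) (n : E -> nat) :
  ptime x -> ptime l -> ptime n -> ptime (fun e => nth (x e) (l e) (n e)).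
Proof.
move=> px pl pn.
apply: (@ptime_ext _ _ _ _ (fun e => head (x e) (iter (n e) behead (l e)))).
  by move=> e; rewrite -drop_behead -nth0 nth_drop addn0.
apply: ptime_head => //.
apply: (@ptime_iter _ _ _ _ _ _ _ (fun e => sz (l e))) => //.
- by ptime_auto.
- exact: ptime_sz.
by move=> e k _; rewrite -drop_behead sz_drop.
Qed.

Lemma ptime_iota E {cE : code E} (n : E -> nat) :
  ptime n -> ptime (fun e => iota 0 (n e)).
Proof.
move=> pn; have := ptime_pb pn => hn.
pose g (s : seq nat) := size s :: s.
have hg k : iter k g [::] = rev (iota 0 k).
  by elim: k => // k IH; rewrite iterS IH /g size_rev size_iota -addn1 iotaD
    rev_cat.
apply: (@ptime_ext _ _ _ _ (fun e => rev (iter (n e) g [::]))).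
  by move=> e; rewrite hg revK.
apply: ptime_rev.
apply: (@ptime_iter _ _ _ _ _ _ _ (fun e => n e * (2 * n e + 2) + 1)) => //.
- by apply: ptime_cons; first apply: ptime_size; ptime_auto.
- exact: ptime_const.
- by pbs.
move=> e k hk; rewrite hg sz_rev.
apply: (@leq_trans (k * (2 * n e + 2) + 1)); last nia.
rewrite -{2}(size_iota 0 k) addn2; apply: sz_all; apply/allP => x.
by rewrite mem_iota sz_nat; lia.
Qed.

Lemma ptime_mkseq E X {cE : code E} {cX : code X} (f : E -> nat -> X) (n : E -> nat) :
  ptime (fun p : E * nat => f p.1 p.2) -> ptime n ->
  ptime (fun e => mkseq (f e) (n e)).
Proof. by move=> pf pn; apply: ptime_map => //; apply: ptime_iota. Qed.

(** The quotient is the number of positive multiples of [d] up to [k]. Such an exhaustive count is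
    affordable because [k] is unary. *)
Lemma divn_count k d : 0 < d ->
  k %/ d = count (fun j => j.+1 * d <= k) (iota 0 k).
Proof.
move=> d0; rewrite (eq_count (a2 := fun j => j < k %/ d)); last first.
  by move=> j; rewrite /= leq_divRL.
have : k %/ d <= k by apply: leq_div.
move: (k %/ d) => m; elim: k m => [|k IH] m; first by rewrite leqn0 => /eqP ->.
rewrite -addn1 iotaD count_cat /= addn0; case: (ltnP k m) => hk hm.
  have -> : m = k.+1 by lia.
  rewrite (eq_in_count (a2 := predT)) ?count_predT ?size_iota ?addn1 //.
  by move=> j; rewrite mem_iota /= => ?; lia.
by rewrite addn0 -IH.
Qed.

Lemma ptime_divn E {cE : code E} (m d : E -> nat) :
  ptime m -> ptime d -> ptime (fun e => m e %/ d e).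
Proof.
move=> pm pd; apply: (@ptime_ext _ _ _ _ (fun e => if d e == 0 then 0 else
    count (fun j => j.+1 * d e <= m e) (iota 0 (m e)))).
  by move=> e; case: eqP => [->|/eqP]; rewrite ?divn0 // -lt0n => /divn_count <-.
apply: ptime_if; [exact: ptime_nat_eq0 | exact: ptime_const|].
apply: (ptime_count (P := fun e j => j.+1 * d e <= m e)); last exact: ptime_iota.
apply: ptime_leq; last by apply: (ptime_comp pm); ptime_auto.
apply: ptime_muln; first by apply: ptime_succ; ptime_auto.
by apply: (ptime_comp pd); ptime_auto.
Qed.

Lemma ptime_modn E {cE : code E} (m d : E -> nat) :
  ptime m -> ptime d -> ptime (fun e => m e %% d e).
Proof.
move=> pm pd; apply: (@ptime_ext _ _ _ _ (fun e => m e - m e %/ d e * d e)).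
  by move=> e; rewrite {1}(divn_eq (m e) (d e)) addKn.
by apply: ptime_subn => //; apply: ptime_muln => //; apply: ptime_divn.
Qed.

Ltac ptime_more ::= first
  [ apply: ptime_nth | apply: ptime_iota | apply: ptime_size
  | apply: ptime_leq | apply: ptime_eqn | apply: ptime_nat_of_bool
  | apply: ptime_addn | apply: ptime_subn | apply: ptime_muln | apply: ptime_divn
  | apply: ptime_modn | apply: ptime_maxn | apply: ptime_minn | apply: ptime_succ
  | apply: ptime_pred ].

(** * Binary numbers *)

(** Truncating at a position, with [false] beyond the end, lets operands of different lengths be
    handled by one induction on the position. *)
Definition pval (s : seq bool) n := \sum_(i < n) nth false s i * 2 ^ i.
Definition bval s := pval s (size s).

Lemma pvalS s n : pval s n.+1 = pval s n + nth false s n * 2 ^ n.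
Proof. by rewrite /pval big_ord_recr. Qed.

Lemma pval_ge s n : size s <= n -> pval s n = bval s.
Proof.
move=> /subnK <-; elim: (n - _) => // k IH.
by rewrite addSn pvalS IH nth_default ?addn0 // leq_addl.
Qed.

Lemma pval_lt s n : pval s n < 2 ^ n.
Proof.
elim: n => [|n IH]; first by rewrite /pval big_ord0.
by rewrite pvalS expnS; case: nth; lia.
Qed.

Lemma pval_cons x s n : pval (x :: s) n.+1 = x + 2 * pval s n.
Proof.
rewrite /pval big_ord_recl muln1 /=; congr addn.
by rewrite big_distrr /=; apply: eq_bigr => i _; rewrite /bump /= add1n expnS mulnCA.
Qed.

Lemma bval_cons x s : bval (x :: s) = x + 2 * bval s.
Proof. exact: pval_cons. Qed.

Lemma bval_nil : bval [::] = 0.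
Proof. by rewrite /bval /pval big_ord0. Qed.

Lemma pval_cat s t n : n <= size s -> pval (s ++ t) n = pval s n.
Proof.
move=> h; apply: eq_bigr => i _; rewrite nth_cat.
by have -> : i < size s by apply: leq_trans h.
Qed.

Lemma bval_rcons s x : bval (rcons s x) = bval s + x * 2 ^ size s.
Proof.
by rewrite /bval size_rcons pvalS nth_rcons ltnn eqxx -cats1 pval_cat.
Qed.

(** The state consists of the carry and of the digits of the sum found so far, the latest one in
    front. *)
Definition add_step (a b : seq bool) (st : bool * seq bool) i :=
  let x := nth false a i in let y := nth false b i in
  (x && y || st.1 && (x || y), x (+) y (+) st.1 :: st.2).

(** The loop goes one position past the longer operand, which makes the final carry zero. Leading
    zeros are kept, so the result has exactly one digit more than the longer operand; the size
    bounds on repeated sums count these digits. *)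
Definition add_bits a b :=
  rev (foldl (add_step a b) (false, [::]) (iota 0 (maxn (size a) (size b)).+1)).2.

Lemma iota_rcons n : iota 0 n.+1 = rcons (iota 0 n) n.
Proof. by rewrite -[in LHS]addn1 iotaD cats1. Qed.

Lemma size_add_step a b n :
  size (foldl (add_step a b) (false, [::]) (iota 0 n)).2 = n.
Proof. by elim: n => // n IH; rewrite iota_rcons foldl_rcons /= IH. Qed.

Lemma add_stepP a b n :
  let st := foldl (add_step a b) (false, [::]) (iota 0 n) in
  bval (rev st.2) + st.1 * 2 ^ n = pval a n + pval b n.
Proof.
elim: n => [|n IH]; first by rewrite /= bval_nil /pval !big_ord0.
move: IH (size_add_step a b n); rewrite iota_rcons foldl_rcons.
set st := foldl _ _ _ => /= IH sz_st.
rewrite rev_cons bval_rcons size_rev sz_st !pvalS expnS.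
by move: IH; case: (st.1); case: (nth false a n); case: (nth false b n) => /=; lia.
Qed.

Lemma size_add_bits a b : size (add_bits a b) = (maxn (size a) (size b)).+1.
Proof. by rewrite size_rev size_add_step. Qed.

Lemma add_bitsP a b : bval (add_bits a b) = bval a + bval b.
Proof.
rewrite /add_bits; set m := maxn _ _.
have ha : size a <= m by apply: leq_maxl.
have hb : size b <= m by apply: leq_maxr.
have := add_stepP a b m.+1.
rewrite (pval_ge (leqW ha)) (pval_ge (leqW hb)).
cbv zeta; set st := foldl _ _ _; case: st.1; last by rewrite mul0n addn0.
rewrite mul1n => h; have := pval_lt a m; have := pval_lt b m.
by rewrite !pval_ge // => hb' ha'; move: h; rewrite expnS; lia.
Qed.

(** Positions are read from the least significant one upwards, so a later difference overrides the
    verdict of the earlier ones. *)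
Definition leq_bits a b :=
  foldl (fun r i => if nth false a i == nth false b i then r else nth false b i)
    true (iota 0 (maxn (size a) (size b))).

Lemma leq_bitsP a b : leq_bits a b = (bval a <= bval b).
Proof.
rewrite -(pval_ge (leq_maxl (size a) (size b))).
rewrite -(pval_ge (leq_maxr (size a) (size b))) /leq_bits.
elim: (maxn _ _) => [|n IH]; first by rewrite /= /pval !big_ord0.
rewrite iota_rcons foldl_rcons /= {}IH !pvalS.
have := pval_lt a n; have := pval_lt b n.
by case: (nth false a n); case: (nth false b n) => /=; lia.
Qed.

Definition muln_bits k a := iter k (add_bits a) [::].

Lemma muln_bitsP k a : bval (muln_bits k a) = k * bval a.
Proof. by elim: k => [|k IH]; rewrite ?bval_nil //= add_bitsP IH mulSn. Qed.

Lemma size_muln_bits k a : size (muln_bits k a) <= size a + k.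
Proof. by elim: k => //= k IH; rewrite size_add_bits; lia. Qed.

(* The cap keeps the unary value short whatever the input is. *)
Definition capped c s := foldr (fun (x : bool) v => minn (x + 2 * v) c) 0 s.

Lemma cappedP c s : capped c s = minn (bval s) c.
Proof. by elim: s => [|x s /= ->]; rewrite ?bval_nil ?min0n ?bval_cons //; lia. Qed.

(** Leading zeros stand at the end of the list; [x] is dropped exactly when it is zero and nothing
    is left after it. *)
Definition strip s :=
  foldr (fun (x : bool) u => if nilp u && ~~ x then [::] else x :: u) [::] s.

Definition digits s := if nilp (strip s) then [:: false] else strip s.

Lemma bval_strip s : bval (strip s) = bval s.
Proof.
elim: s => //= x s IH; rewrite bval_cons -IH.
by case: (strip s) x {IH} => [|y t] [] //=; rewrite ?bval_cons ?bval_nil.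
Qed.

Lemma strip_last s : last true (strip s).
Proof. by elim: s => //= x s; case: (strip s) x => [|y t] []. Qed.

Lemma nth_bval s k : nth false s k = odd (bval s %/ 2 ^ k).
Proof.
elim: s k => [|x s IH] [|k] /=; rewrite ?bval_nil ?div0n ?nth_nil // bval_cons.
  by rewrite expn0 divn1 oddD oddM oddb addbF.
rewrite IH expnS divnMA; congr (odd (_ %/ _)).
by rewrite addnC mulnC divnMDl // divn_small ?addn0 //; case: x.
Qed.

Definition nat_bits m := [seq odd (m %/ 2 ^ k) | k <- iota 0 (trunc_log 2 m).+1].

Lemma digitsP s : digits s = nat_bits (bval s).
Proof.
rewrite -bval_strip /digits; have := strip_last s.
case: (lastP (strip s)) => [|t x]; first by rewrite bval_nil /nat_bits trunc_log0.
rewrite last_rcons => -> {x}; have -> : nilp (rcons t true) = false by case: t.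
rewrite /nat_bits; set m := bval _; have em : trunc_log 2 m = size t.
  have := pval_lt t (size t); rewrite -/(bval t) /m bval_rcons mul1n => h.
  by apply: trunc_log_eq => //; rewrite expnS; lia.
apply: (@eq_from_nth _ false); first by rewrite size_map size_iota em size_rcons.
move=> i; rewrite size_rcons => hi.
by rewrite (nth_map 0) ?size_iota ?em // nth_iota // nth_bval.
Qed.

Lemma nat_bitsP m : bval (nat_bits m) = m.
Proof.
have h n : pval [seq odd (m %/ 2 ^ k) | k <- iota 0 n] n = m %% 2 ^ n.
  elim: n => [|n IH]; first by rewrite /pval big_ord0 modn1.
  rewrite pvalS (nth_map 0) ?size_iota // nth_iota // add0n.
  rewrite iota_rcons map_rcons -cats1 pval_cat ?size_map ?size_iota // IH.
  set q := m %/ 2 ^ n; set r := m %% 2 ^ n.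
  have em : m = q./2 * 2 ^ n.+1 + (odd q * 2 ^ n + r).
    rewrite {1}(divn_eq m (2 ^ n)) -/q -/r -{1}(odd_double_half q) -mul2n expnS.
    by rewrite mulnDl -!mulnA addnCA addnA (mulnCA 2).
  rewrite [in RHS]em modnMDl modn_small 1?addnC //.
  have : r < 2 ^ n by rewrite ltn_mod expn_gt0.
  by rewrite expnS; case: odd; lia.
by rewrite /bval size_map size_iota h modn_small // trunc_log_ltn.
Qed.

Lemma enc_natE m : enc_nat m = [seq Some x | x <- nat_bits m].
Proof. by rewrite /enc_nat -map_comp. Qed.

Lemma sz_bits (s : seq bool) : sz s <= 4 * size s + 1.
Proof.
apply: leq_trans (@sz_all _ _ 3 s _) _; last by lia.
by elim: s => //= -[].
Qed.

Lemma ptime_add_bits E {cE : code E} (f g : E -> seq bool) :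
  ptime f -> ptime g -> ptime (fun e => add_bits (f e) (g e)).
Proof.
move=> pf pg; have := ptime_pb (ptime_size pf); have := ptime_pb (ptime_size pg).
move=> hg hf; rewrite /add_bits; apply/ptime_rev/ptime_snd.
apply: (@ptime_foldl _ _ _ _ _ _ (fun e => add_step (f e) (g e)) _ _
  (fun e => 4 * (size (f e) + size (g e) + 1) + 10)).
- have pf' : ptime (fun p : E * (bool * seq bool) * nat => f p.1.1).
    by apply: (ptime_comp pf); ptime_auto.
  have pg' : ptime (fun p : E * (bool * seq bool) * nat => g p.1.1).
    by apply: (ptime_comp pg); ptime_auto.
  by rewrite /add_step; ptime_auto.
- by ptime_auto.
- by ptime_auto.
- by pbs.
move=> e k; rewrite take_iota; set n := minn _ _.
have := size_add_step (f e) (g e) n; set st := foldl _ _ _ => hs.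
have := sz_bits st.2; rewrite hs [st]surjective_pairing sz_pair.
have : sz st.1 <= 3 by case: st.1.
by rewrite /n /=; lia.
Qed.

Lemma ptime_leq_bits E {cE : code E} (f g : E -> seq bool) :
  ptime f -> ptime g -> ptime (fun e => leq_bits (f e) (g e)).
Proof.
move=> pf pg; rewrite /leq_bits.
apply: (@ptime_foldl _ _ _ _ _ _ (fun e r i => if nth false (f e) i ==
  nth false (g e) i then r else nth false (g e) i) _ _ (fun e => 3)).
- have pf' : ptime (fun p : E * bool * nat => f p.1.1).
    by apply: (ptime_comp pf); ptime_auto.
  have pg' : ptime (fun p : E * bool * nat => g p.1.1).
    by apply: (ptime_comp pg); ptime_auto.
  by ptime_auto.
- by ptime_auto.
- by ptime_auto.
- by pbs.
by move=> e k; case: foldl.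
Qed.

Lemma ptime_muln_bits E {cE : code E} (k : E -> nat) (f : E -> seq bool) :
  ptime k -> ptime f -> ptime (fun e => muln_bits (k e) (f e)).
Proof.
move=> pk pf; have := ptime_pb (ptime_size pf); have := ptime_pb pk => hk hf.
apply: (@ptime_iter _ _ _ _ (fun e => add_bits (f e)) _ _
  (fun e => 4 * (size (f e) + k e) + 1)) => //.
- by apply: ptime_add_bits; [apply: (ptime_comp pf)|]; ptime_auto.
- by ptime_auto.
- by pbs.
move=> e j hj; rewrite -/(muln_bits j (f e)).
apply: leq_trans (sz_bits _) _; have := size_muln_bits j (f e); lia.
Qed.

Lemma ptime_capped E {cE : code E} (c : E -> nat) (f : E -> seq bool) :
  ptime c -> ptime f -> ptime (fun e => capped (c e) (f e)).
Proof.
move=> pc pf; have hc := ptime_pb pc.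
apply: (@ptime_foldr _ _ _ _ _ _ (fun e (x : bool) v => minn (x + 2 * v) (c e))
  _ _ (fun e => 2 * c e + 1)) => //.
- have pc' : ptime (fun p : E * bool * nat => c p.1.1).
    by apply: (ptime_comp pc); ptime_auto.
  by ptime_auto.
- by ptime_auto.
- by pbs.
by move=> e k; rewrite sz_nat -/(capped _ _) cappedP; lia.
Qed.

Lemma ptime_digits E {cE : code E} (f : E -> seq bool) :
  ptime f -> ptime (fun e => digits (f e)).
Proof.
move=> pf; have hf := ptime_pb (ptime_size pf).
have ps : ptime (fun e => strip (f e)).
  apply: (@ptime_foldr _ _ _ _ _ _ (fun _ (x : bool) u => if nilp u && ~~ x then [::]
    else x :: u) _ _ (fun e => 4 * size (f e) + 1)) => //; try by ptime_auto.
    by pbs.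
  move=> e k; rewrite -/(strip _); apply: leq_trans (sz_bits _) _.
  have h s : size (strip s) <= size s.
    by elim: s => //= x s IH; case: ifP => //=.
  by have := h (drop k (f e)); rewrite size_drop; lia.
by rewrite /digits; ptime_auto.
Qed.

(** * Input and output *)

(** The raw word becomes the prefix code of the list of its letters. Reading it from its last
    letter, after a first reversal, turns each cons into pushes in front of the code built so
    far. *)
Definition encode_letter (x : letter) :=
  Seq (pushw 0 (Some true :: str (x : option bool))) (Pop 1).
Definition encode_loop := While 1 isSome (bylet 1 encode_letter).
Definition encode := block [:: xfer 0 1; Push 0 (Some false); encode_loop].

Lemma run_encode_loop (v u : seq (option bool)) :
  run encode_loop (stacks [:: str u; v]) (20 * size v + 1)
    (stacks [:: str (rev v ++ u)]).
Proof.
elim: v u => [|x v IH] u.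
  rewrite (_ : stacks _ = stacks [:: str u]); last by same_stacks.
  exact: run_stop.
have e : rev (x :: v) ++ u = rev v ++ x :: u by rewrite rev_cons cat_rcons.
apply: run_le.
  apply: run_loop => //.
    apply: run_bylet; first by rewrite /stacks /=; reflexivity.
    apply: run_seq; [exact: srun_pushw | exact: srun_pop].
  cbn [set_nth nth behead]; rewrite e; have := IH (x :: u).
  by rewrite {1}/str /=; apply.
have : size (str x) <= 5 by case: x {e} => [[]|].
by rewrite /=; lia.
Qed.

Lemma run_encode (w : seq (option bool)) :
  run encode (stacks [:: w]) (30 * size w + 20) (stacks [:: str w]).
Proof.
apply: run_le.
  steps; rewrite cats0.
  apply: run_block; first exact: (run_encode_loop (rev w) [::]).
  by rewrite revK cats0; apply: run_block_nil.
by sizes.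
Qed.

(** A cell starts with [true] for the cons; then the bit [true] is coded by three letters,
    [true false false], and the bit [false] by one. *)
Definition decode_loop := While 0 (pred1 (Some (Some true)))
  (Seq (Pop 0) (If 0 (pred1 (Some (Some true)))
     (block [:: Pop 0; Pop 0; Pop 0; Push 1 (Some true)])
     (block [:: Pop 0; Push 1 (Some false)]))).

Lemma run_decode_loop (s : seq bool) v :
  run decode_loop (stacks [:: str s; v]) (20 * size s + 1)
    (stacks [:: str ([::] : seq bool); rev [seq Some x | x <- s] ++ v]).
Proof.
elim: s v => [|x s IH] v; first exact: run_stop.
apply: (@run_le _ _ (19 + (20 * size s + 1)).+1); last by rewrite /=; lia.
apply: (run_loop (s2 := stacks [:: str s; Some x :: v])) => //; last first.
  by rewrite /= rev_cons cat_rcons; apply: IH.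
apply: run_le.
  apply: run_seq; first exact: srun_pop.
  cbn [set_nth nth behead].
  case: x; [apply: (@run_le _ _ 10)|apply: (@run_le _ _ 10)]; try exact: leqnn.
    by apply: run_le; first (apply: run_then => //; halt).
  by apply: run_le; first (apply: run_else => //; halt).
by [].
Qed.

Lemma sz_letters (w : seq (option bool)) : sz w <= 6 * size w + 1.
Proof.
rewrite mulnC; apply: sz_all.
by elim: w => //= -[[]|].
Qed.

Lemma polytime_of_ptime (X : Type) (P : X -> Prop) (encX : X -> seq letter)
    (f : X -> nat) (g : seq (option bool) -> seq bool) :
  ptime g -> (forall x, P x -> g (encX x) = nat_bits (f x)) ->
  polytime_computable P encX enc_nat f.
Proof.
move=> pg hg; have [[p [T [hT h]]]] := pg.
(* Stack [K] is the last tape, hence the output. It must differ from stack 1 and leave room for all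
   the stacks of the program. *)
pose K := (width p + 3).
pose prg := Seq encode (Seq p (Seq decode_loop (xfer 1 K))).
pose (time := fun w : seq (option bool) =>
  30 * sz w + 20 + (T w + (20 * sz (g w) + 1 + (6 * sz (g w) + 1)))).
have [k hk] : pb time by have := ptime_sz pg; rewrite /time => ?; pbs.
(* The code of a word of length [m] has size at most [6 * m + 1], to which [pb] adds 2. *)
exists (machine K prg), ((6%:P * 'X + 3%:P) ^+ k)%R => x Px.
have := hg x Px; set w := encX x; rewrite enc_natE.
move: (nat_bits (f x)) => v hv.
have [m mT ex] : run prg (stacks [:: w]) (time w)
    (upd (upd (stacks [:: str ([::] : seq bool);
      rev [seq Some y | y <- v]]) 1 [::]) K (rev (rev [seq Some y | y <- v]))).
  apply: run_le.
    apply: run_seq; first exact: run_encode.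
    apply: run_seq; first exact: h.
    rewrite hv.
    have := run_seq (run_decode_loop v [::]) (run_xfer (i := 1) (j := K) _ _).
    rewrite (_ : stacks [:: str v; [::]] = stacks [:: str v]); last by same_stacks.
    rewrite cats0 /=.
    rewrite (_ : stacks _ K = [::]) ?cats0; last first.
      by rewrite /stacks nth_default // /K addn3.
    by apply; rewrite /K addn3.
  rewrite /time hv size_rev size_map.
  by have := size_sz (cX := code_bool) v; have := size_sz (cX := code_option code_bool) w; lia.
apply: (exec_outputs ex).
- by rewrite /upd eqxx revK.
- have K1 : 1 < K by rewrite /K addn3.
  have wp : width p <= K.+1 by rewrite /K addn3; do 4!apply: leqW.
  by rewrite /= !geq_max !ltnS leqnn wp (ltnW K1).
apply: (leq_trans mT); apply: (leq_trans (hk w)).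
rewrite horner_exp hornerD hornerM hornerX !hornerC natrXE.
rewrite -[X in _ <= X ^ k]/(6 * size w + 3).
case: (k) => // j; rewrite leq_exp2r // addn3 !ltnS -(addn1 (6 * _)); exact: sz_letters.
Qed.

(** * The algorithm *)

(** The input is scanned from the right: a separator opens an empty word, and a bit goes in front of
    the current word. The default of [head] is reached only when no word is open, that is, for bits
    that no separator follows. *)
Definition tokens_step (x : option bool) (u : seq (seq bool)) :=
  if isSome x then (odflt false x :: head [::] u) :: behead u else [::] :: u.

Definition tokens := foldr tokens_step [::].

Section Decision.
Variable t : seq (seq bool).

(** Layout of the tokens for [n] vertices: the rows of the matrix at [0] to [n - 1], the numerator
    and the denominator of the label of [v] at [n + 2 * v] and the next place, then the quota, the
    players and the actor at [3 * n], [3 * n + 1] and [3 * n + 2]. *)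
Definition order := size (head [::] t).
Definition arc u v := nth false (nth [::] t u) v.
Definition label_le k v :=
  leq_bits (nth [::] t (order + 2 * v)) (muln_bits k (nth [::] t (order + 2 * v).+1)).
Definition quota_of := capped order (nth [::] t (3 * order)).
Definition player v := nth false (nth [::] t (3 * order).+1) v.
Definition actor_of := capped order (nth [::] t (3 * order).+2).

(** The members of [L] and [R] are the players with an outgoing arc, and those of [R] have an
    incoming arc as well. The centre is the non-player with an arc from a player; if there are no
    leaves, no hub is found, and indeed nothing spreads when labels are positive. *)
Definition leaf v := player v && has (fun u => arc v u) (iota 0 order).
Definition easy v :=
  leaf v && has (fun u => arc u v) (iota 0 order) && label_le 1 v.
Definition hub v :=
  ~~ player v && has (fun u => player u && arc u v) (iota 0 order).
Definition awake k := has (fun v => hub v && label_le k v) (iota 0 order).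
(** A non-player other than the centre lies in [F], hence is a successor of the centre, and only its
    label has to be tested. *)
Definition recruit v := easy v || ~~ player v && (hub v || label_le 1 v).
Definition recruits := count recruit (iota 0 order).

(** Each digit of a key counts vertices, so it is at most [order] and adding weights never
    carries. *)
Definition base := order.+1.

(* A configuration is counted under the number whose digits in base [base] are
   the number of active non-easy leaves, of active easy leaves and of active
   isolated players, followed by the vote of the actor. *)
Definition weight v :=
  (if player v then if leaf v then if easy v then base else 1 else base * base
   else 0) + (if v == actor_of then base * base * base else 0).

Definition favourable k :=
  let a := k %% base in
  let b := (k %/ base) %% base in
  let c := (k %/ (base * base)) %% base in
  (* Once the centre is active, the easy leaves are all among the recruits, whether or not they were
     active before, so [b] is not added. *)
  (if awake (a + b) then quota_of <= a + c + recruits else quota_of <= a + b + c)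
    == (0 < k %/ (base * base * base)).

Definition keys := 2 * (base * base * base).

Definition table_step (T : seq (seq bool)) v :=
  mkseq (fun i => add_bits (nth [::] T i)
    (* The test is essential: below the weight, truncated subtraction would give the entry at index
       0. *)
    (if i < weight v then [::] else nth [::] T (i - weight v))) keys.

Definition table := foldl table_step [:: [:: true]] (iota 0 order).

Definition total :=
  foldl (fun s k => if favourable k then add_bits s (nth [::] table k) else s)
    [::] (iota 0 keys).

End Decision.

Definition sat_digits w := digits (total (tokens w)).

(** * Running time of the algorithm *)

Lemma sz_nil X {cX : code X} : sz ([::] : seq X) = 1.
Proof. by []. Qed.

Lemma sz_tokens w : sz (tokens w) <= 6 * size w + 1.
Proof.
elim: w => //= x w IH; rewrite mulnS -addnA; apply: leq_trans (leq_add (leqnn 6) IH).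
rewrite /tokens_step; case: x => [x|] /=; last by rewrite sz_cons sz_nil; lia.
have : sz x <= 3 by case: x.
by case: (tokens w) => [|u U] /=; rewrite !(sz_cons, sz_nil); lia.
Qed.

Lemma ptime_tokens : ptime tokens.
Proof.
apply: (@ptime_foldr _ _ _ _ _ _ (fun _ => tokens_step) (fun _ => [::]) (fun w => w)
  (fun w => 6 * sz w + 1)).
- by rewrite /tokens_step; ptime_auto.
- by ptime_auto.
- by ptime_auto.
- by pbs.
move=> w k; apply: leq_trans (sz_tokens _) _; rewrite size_drop.
by have := size_sz (cX := code_option code_bool) w; lia.
Qed.

Lemma ptime_comp2 E X Y Z {cE : code E} {cX : code X} {cY : code Y} {cZ : code Z}
    (g : X -> Y -> Z) (x : E -> X) (y : E -> Y) :
  ptime (fun p : X * Y => g p.1 p.2) -> ptime x -> ptime y ->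
  ptime (fun e => g (x e) (y e)).
Proof. by move=> pg px py; apply: (ptime_comp pg (ptime_pair px py)). Qed.

Lemma ptime_comp3 E X Y Z W {cE : code E} {cX : code X} {cY : code Y} {cZ : code Z}
    {cW : code W} (g : X -> Y -> Z -> W) (x : E -> X) (y : E -> Y) (z : E -> Z) :
  ptime (fun p : X * Y * Z => g p.1.1 p.1.2 p.2) -> ptime x -> ptime y -> ptime z ->
  ptime (fun e => g (x e) (y e) (z e)).
Proof.
by move=> pg px py pz; apply: (ptime_comp pg (ptime_pair (ptime_pair px py) pz)).
Qed.

Notation inst := (seq (seq bool)).

Ltac ptime_more ::= first
  [ apply: ptime_nth | apply: ptime_iota | apply: ptime_size
  | apply: ptime_leq | apply: ptime_eqn | apply: ptime_nat_of_bool
  | apply: ptime_addn | apply: ptime_subn | apply: ptime_muln | apply: ptime_divn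
  | apply: ptime_modn | apply: ptime_maxn | apply: ptime_minn | apply: ptime_succ
  | apply: ptime_pred | apply: ptime_leq_bits | apply: ptime_muln_bits
  | apply: ptime_capped | apply: ptime_add_bits | apply: ptime_digits
  | apply: ptime_has | apply: ptime_count | apply: ptime_mkseq ].

Lemma ptime_order : ptime order.
Proof. by rewrite /order; ptime_auto. Qed.

Lemma ptime_arc : ptime (fun p : inst * nat * nat => arc p.1.1 p.1.2 p.2).
Proof. by rewrite /arc; ptime_auto. Qed.

Lemma ptime_label_le : ptime (fun p : inst * nat * nat => label_le p.1.1 p.1.2 p.2).
Proof. by rewrite /label_le; ptime_auto; apply: (ptime_comp ptime_order); ptime_auto. Qed.

Lemma ptime_quota_of : ptime quota_of.
Proof. by rewrite /quota_of; ptime_auto; apply: ptime_order. Qed.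

Lemma ptime_actor_of : ptime actor_of.
Proof. by rewrite /actor_of; ptime_auto; apply: ptime_order. Qed.

Lemma ptime_player : ptime (fun p : inst * nat => player p.1 p.2).
Proof. by rewrite /player; ptime_auto; apply: (ptime_comp ptime_order); ptime_auto. Qed.

Ltac decision := first
  [ apply: (ptime_comp ptime_order) | apply: (ptime_comp3 ptime_arc)
  | apply: (ptime_comp3 ptime_label_le) | apply: (ptime_comp2 ptime_player)
  | apply: (ptime_comp ptime_quota_of) | apply: (ptime_comp ptime_actor_of)].

Lemma ptime_leaf : ptime (fun p : inst * nat => leaf p.1 p.2).
Proof. by rewrite /leaf; repeat (ptime_auto; try decision). Qed.

Lemma ptime_easy : ptime (fun p : inst * nat => easy p.1 p.2).
Proof.
rewrite /easy; repeat (ptime_auto; try first [apply: (ptime_comp2 ptime_leaf) | decision]).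
Qed.

Lemma ptime_hub : ptime (fun p : inst * nat => hub p.1 p.2).
Proof. by rewrite /hub; repeat (ptime_auto; try decision). Qed.

Lemma ptime_awake : ptime (fun p : inst * nat => awake p.1 p.2).
Proof.
rewrite /awake; repeat (ptime_auto; try first [apply: (ptime_comp2 ptime_hub) | decision]).
Qed.

Lemma ptime_recruit : ptime (fun p : inst * nat => recruit p.1 p.2).
Proof.
rewrite /recruit; repeat (ptime_auto; try first
  [apply: (ptime_comp2 ptime_hub) | apply: (ptime_comp2 ptime_easy) | decision]).
Qed.

Lemma ptime_recruits : ptime recruits.
Proof.
rewrite /recruits; repeat (ptime_auto; try first
  [apply: (ptime_comp2 ptime_recruit) | decision]).
Qed.

Lemma ptime_base : ptime base.
Proof. by rewrite /base; apply: ptime_succ; apply: ptime_order. Qed.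

Lemma ptime_keys : ptime keys.
Proof. by rewrite /keys; ptime_auto; apply: ptime_base. Qed.

Lemma ptime_weight : ptime (fun p : inst * nat => weight p.1 p.2).
Proof.
rewrite /weight; repeat (ptime_auto; try first
  [apply: (ptime_comp2 ptime_leaf) | apply: (ptime_comp2 ptime_easy)
  | apply: (ptime_comp ptime_base) | decision]).
Qed.

Lemma ptime_favourable : ptime (fun p : inst * nat => favourable p.1 p.2).
Proof.
rewrite /favourable; repeat (ptime_auto; try first
  [apply: (ptime_comp2 ptime_awake) | apply: (ptime_comp ptime_recruits)
  | apply: (ptime_comp ptime_base) | decision]).
Qed.

Lemma ptime_table_step : ptime (fun p : inst * inst * nat => table_step p.1.1 p.1.2 p.2).
Proof.
rewrite /table_step; repeat (ptime_auto; try first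
  [apply: (ptime_comp2 ptime_weight) | apply: (ptime_comp ptime_keys) | decision]).
Qed.

Lemma size_table_step t T v m :
  (forall i, size (nth [::] T i) <= m) ->
  forall i, size (nth [::] (table_step t T v) i) <= m.+1.
Proof.
move=> h i; case: (ltnP i (keys t)) => hi; last by rewrite nth_default // size_mkseq.
by rewrite nth_mkseq // size_add_bits; case: ifP => _; have := h i; have := h (i - weight t v) => /=; lia.
Qed.

(** Each vertex costs one addition per entry, hence one digit. This keeps the accumulator of the
    fold small although the entries may be exponential. *)
Lemma size_table_prefix t k i :
  size (nth [::] (foldl (table_step t) [:: [:: true]] (iota 0 k)) i) <= k.+1.
Proof.
elim: k i => [|k IH] i; first by case: i => [|[|i]].
by rewrite iota_rcons foldl_rcons; apply: size_table_step.
Qed.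

Lemma ptime_table : ptime table.
Proof.
have ho := ptime_pb ptime_order; have hk := ptime_pb ptime_keys.
apply: (@ptime_foldl _ _ _ _ _ _ (fun t => table_step t) (fun _ => [:: [:: true]])
  (fun t => iota 0 (order t))
  (fun t => (keys t + 1) * (4 * (order t + 1) + 2) + 1)).
- exact: ptime_table_step.
- by ptime_auto.
- by ptime_auto; apply: ptime_order.
- by pbs.
move=> t k; rewrite take_iota; set j := minn _ _; set T := foldl _ _ _.
apply: (@leq_trans (size T * (4 * (order t + 1) + 1).+1 + 1)).
  apply: sz_all; apply/(all_nthP [::]) => i _.
  apply: leq_trans (sz_bits _) _; rewrite leq_add2r leq_mul2l /=.
  by apply: leq_trans (size_table_prefix t j i) _; rewrite addn1 ltnS geq_minr.
rewrite -addn1 -addnA leq_add2r leq_mul2r; apply/orP; right.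
rewrite /T; case: (j) => [|j']; first by rewrite addn1.
by rewrite iota_rcons foldl_rcons size_mkseq addn1.
Qed.

Lemma size_total_prefix t k :
  size (foldl (fun s k => if favourable t k then add_bits s (nth [::] (table t) k)
    else s) [::] (iota 0 k)) <= k + (order t).+1.
Proof.
elim: k => [|k IH] //; rewrite iota_rcons foldl_rcons; case: ifP => _; last by lia.
by rewrite size_add_bits; have := size_table_prefix t (order t) k; rewrite -/(table t); lia.
Qed.

Lemma ptime_total : ptime total.
Proof.
have ho := ptime_pb ptime_order; have hk := ptime_pb ptime_keys.
apply: (@ptime_foldl _ _ _ _ _ _ (fun t s k => if favourable t k then
  add_bits s (nth [::] (table t) k) else s) (fun _ => [::])
  (fun t => iota 0 (keys t)) (fun t => 4 * (keys t + order t + 1) + 1)).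
- repeat (ptime_auto; try first [ apply: (ptime_comp2 ptime_favourable)
    | apply: (ptime_comp ptime_table) ]).
- by ptime_auto.
- by ptime_auto; apply: ptime_keys.
- by pbs.
move=> t k; rewrite take_iota; apply: leq_trans (sz_bits _) _.
by have := size_total_prefix t (minn k (keys t)); lia.
Qed.

Lemma ptime_sat_digits : ptime sat_digits.
Proof.
apply: ptime_digits; apply: (ptime_comp ptime_total); exact: ptime_tokens.
Qed.

(** * Spread in a star *)

Section Star.
Variables (V : finType) (g : influence_game V) (L I R F : {set V}) (c : V).
Hypothesis star_g : is_star g L I R c F.
Hypothesis players_g : players g = L :|: R :|: I.
Hypothesis label_gt0 : positive_labels g.

Definition is_leaf_player v := (v \in players g) && [exists u, edge g v u].
Definition is_easy v :=
  is_leaf_player v && [exists u, edge g u v] && (label g v <= 1)%R.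
Definition is_hub v :=
  (v \notin players g) && [exists u, (u \in players g) && edge g u v].
Definition is_awake k := [exists v, is_hub v && (label g v <= k%:R)%R].
Definition is_recruit v :=
  is_easy v || (v \notin players g) && (is_hub v || (label g v <= 1)%R).

(** The partition as a single equation: with it, every membership question about a vertex is settled
    by cases on five booleans. *)
Lemma star_split v :
  (v \in L) + (v \in I) + (v \in R) + (v == c) + (v \in F) = 1.
Proof.
have [/= hd hu _] := star_g.
have := in_setT v; rewrite -hu !inE.
have h (A B : {set V}) : [disjoint A & B] = true -> (v \in A) && (v \in B) = false.
  by rewrite -setI_eq0 => /eqP/setP/(_ v); rewrite !inE.
move: hd; rewrite !andbT -!andbA.
case/and5P=> h1 h2 h3 h4 /and5P[h5 h6 h7 h8 /andP[h9 h10]].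
move: (h _ _ h1) (h _ _ h2) (h _ _ h3) (h _ _ h4) (h _ _ h5) (h _ _ h6) (h _ _ h7)
  (h _ _ h8) (h _ _ h9) (h _ _ h10); rewrite !inE.
by do 4![case: (v \in _)]; case: (v == c).
Qed.

Lemma in_players v : (v \in players g) = (v != c) && (v \notin F).
Proof.
rewrite players_g !inE; have := star_split v.
by do 4![case: (v \in _)]; case: (v == c).
Qed.

Lemma edge_star u v : edge g u v =
  ((u \in L :|: R) && (v == c)) || ((u == c) && (v \in R :|: F)).
Proof. by case: star_g. Qed.

(** Isolated players have no outgoing arc, and the centre, which may have some, is not a player. *)
Lemma is_leaf_playerE v : is_leaf_player v = (v \in L :|: R).
Proof.
rewrite /is_leaf_player in_players !inE; have := star_split v.
have -> : [exists u, edge g v u] = (v \in L) || (v \in R) || (v == c) && (R :|: F != set0).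
  apply/existsP/idP => [[u]|].
    rewrite edge_star !inE => /orP[/andP[->]//|/andP[-> h]].
    by apply/orP; right; apply/set0Pn; exists u; rewrite inE.
  case/orP => [h|/andP[/eqP -> /set0Pn[u hu]]].
    by exists c; rewrite edge_star !inE h eqxx.
  by exists u; rewrite edge_star eqxx hu orbT.
by case: (_ != set0); do 4![case: (v \in _)]; case: (v == c).
Qed.

Lemma is_easyE v : is_easy v = (v \in R) && (label g v <= 1)%R.
Proof.
rewrite /is_easy is_leaf_playerE; congr (_ && _).
have -> : [exists u, edge g u v] =
    (v \in R :|: F) || (v == c) && (L :|: R != set0).
  apply/existsP/idP => [[u]|].
    rewrite edge_star => /orP[/andP[h ->]|/andP[_ ->] //].
    by apply/orP; right; apply/set0Pn; exists u.
  case/orP => [h|/andP[/eqP -> /set0Pn[u hu]]].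
    by exists c; rewrite edge_star h eqxx orbT.
  by exists u; rewrite edge_star eqxx hu.
have := star_split v; rewrite !inE.
by case: (_ != set0); do 4![case: (v \in _)]; case: (v == c).
Qed.

(** The only predecessor of a vertex of [F] is the centre, which is not a player. *)
Lemma is_hubE v : is_hub v = (v == c) && (L :|: R != set0).
Proof.
rewrite /is_hub in_players negb_and !negbK; apply/andP/andP => [[hv]|[/eqP ->]].
  case/existsP=> u /andP[]; rewrite in_players edge_star.
  case/andP=> /negPf -> _; rewrite orbF => /andP[hu ->]; split=> //.
  by apply/set0Pn; exists u.
case/set0Pn=> u hu; rewrite eqxx; split=> //.
apply/existsP; exists u; rewrite edge_star hu eqxx andbT in_players.
by have := star_split u; move: hu; rewrite !inE;
  do 4![case: (u \in _)]; case: (u == c).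
Qed.

Lemma is_awakeE k : is_awake k = (L :|: R != set0) && (label g c <= k%:R)%R.
Proof.
apply/existsP/andP => [[v]|[h hk]].
  by rewrite is_hubE => /andP[/andP[/eqP -> ->]].
by exists c; rewrite is_hubE eqxx h.
Qed.

Lemma is_recruitE v : L :|: R != set0 ->
  is_recruit v = (v == c) || (v \in R :|: F) && (label g v <= 1)%R.
Proof.
move=> h; rewrite /is_recruit is_easyE is_hubE h in_players !inE andbT.
have := star_split v; case: (_ <= _)%R;
by do 4![case: (v \in _)]; case: (v == c).
Qed.

Definition spread_step (Y : {set V}) :=
  Y :|: [set i | (label g i <= #|preds g i :&: Y|%:R)%R].

Lemma preds_star v : preds g v =
  if v == c then L :|: R else if v \in R :|: F then [set c] else set0.
Proof.
apply/setP => u; rewrite inE edge_star.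
have [->|vc] := eqVneq v c.
  have := star_split c; rewrite eqxx !inE andbT.
  by do 4![case: (c \in _)]; rewrite // andbF orbF.
by case: ifP => hv; rewrite andbF /= !inE ?andbT ?andbF.
Qed.

(** A vertex other than the centre has at most one predecessor, so its label is compared with 0 or
    1, and positivity excludes 0. *)
Lemma spread_stepE (Y : {set V}) : spread_step Y = Y :|: [set v |
  if v == c then (label g c <= #|Y :&: (L :|: R)|%:R)%R
  else [&& v \in R :|: F, c \in Y & (label g v <= 1)%R]].
Proof.
apply/setP => v; rewrite !in_setU; congr (_ || _); rewrite !in_set preds_star.
case: eqP => [->|_]; first by rewrite setIC.
have h0 : (label g v <= 0)%R = false by rewrite Order.TotalTheory.leNgt label_gt0.
rewrite -in_setU; case: ifP => hv; last by rewrite set0I cards0.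
case: (boolP (c \in Y)) => hc.
  have -> : [set c] :&: Y = [set c] by apply/setIidPl; rewrite sub1set.
  by rewrite cards1.
have -> : [set c] :&: Y = set0.
  by apply/setP => u; rewrite !inE; case: eqP => // ->; rewrite (negPf hc).
by rewrite cards0.
Qed.

Lemma spread_fixed (X Y : {set V}) k : k <= #|V| -> spread_upto g k X = Y ->
  spread_step Y = Y -> spread g X = Y.
Proof.
rewrite /spread => /subnK <- hk hY; elim: (_ - k) => [//|j IH].
by rewrite addSn /= IH; apply: hY.
Qed.

Lemma spreadE (A : {set V}) : A \subset players g ->
  spread g A = if is_awake #|A :&: [set v | is_leaf_player v]|
    then A :|: [set v | is_recruit v] else A.
Proof.
move=> sA.
have -> : [set v | is_leaf_player v] = L :|: R.
  by apply/setP => v; rewrite in_set is_leaf_playerE.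
have cA : c \notin A.
  by apply/negP => /(subsetP sA); rewrite in_players eqxx.
rewrite is_awakeE; case: ifP => [/andP[h0 hk]|hk].
  (* Two rounds are needed, one for the centre and one for the recruits, and the spread has [#|V|]
     rounds; the centre and any leaf are two vertices. *)
  have c2 : 2 <= #|V|.
    have [u hu] := set0Pn _ h0.
    have uc : u != c.
      by have := star_split u; move: hu; rewrite !inE; case: eqP => // _;
        do 4![case: (u \in _)].
    have := max_card (mem [set u; c]); by rewrite cards2 uc.
  have step1 : spread_step A = c |: A.
    rewrite spread_stepE; apply/setP => v; rewrite in_setU in_set in_setU1 (negPf cA).
    by case: eqP => [_|_]; rewrite ?hk ?orbT // andbF orbF.
  have step2 (Y : {set V}) : A \subset Y -> c \in Y ->
      spread_step Y = Y :|: [set v | is_recruit v].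
    move=> AY cY; rewrite spread_stepE; apply/setP => v.
    rewrite !in_setU !in_set is_recruitE // cY !in_setU.
    by have [->|//] := eqVneq v c; rewrite cY.
  apply: (spread_fixed (k := 2)) => //=.
    rewrite -/(spread_step A) step1 -/(spread_step (c |: A)).
    rewrite step2 ?subsetU1 ?setU11 //; apply/setP => v.
    rewrite !in_setU in_set1 in_set is_recruitE //.
    by case: (v == c); rewrite ?orbT.
  rewrite step2 ?subsetUl // -?setUA ?setUid //.
  by rewrite in_setU in_set is_recruitE // eqxx orbT.
apply: (spread_fixed (k := 0)) => //.
rewrite spread_stepE; apply/setP => v; rewrite in_setU in_set (negPf cA).
case: eqP => [->|_]; last by rewrite andbF orbF.
(* If the centre reached its threshold, the failed test would mean that there are no leaves, and
   then its label would be at most 0. *)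
rewrite (negPf cA) /=; apply/negP => h; move: hk; rewrite h andbT => /negbFE/eqP e0.
by move: h; rewrite e0 setI0 cards0 Order.TotalTheory.leNgt label_gt0.
Qed.

End Star.

(** * Correctness *)

Lemma tokens_delimited s w :
  tokens (delimited [seq Some b | b <- s] ++ w) = s :: tokens w.
Proof.
elim: s => // b s IH.
by rewrite -[LHS]/(tokens_step (Some b) (tokens (delimited (map Some s) ++ w))) IH.
Qed.

Lemma tokens_flatten (T : Type) (f : T -> seq letter) (h : T -> seq (seq bool)) l w :
  (forall u w', tokens (f u ++ w') = h u ++ tokens w') ->
  tokens (flatten [seq f u | u <- l] ++ w) = flatten [seq h u | u <- l] ++ tokens w.
Proof. by move=> e; elim: l => //= u l IH; rewrite -!catA e IH. Qed.

Lemma nth_flatten_pairs (S T : Type) (x0 : T) (u0 : S) (f h : S -> T) l k b :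
  k < size l ->
  nth x0 (flatten [seq [:: f u; h u] | u <- l]) (2 * k + nat_of_bool b) =
  (if b then h else f) (nth u0 l k).
Proof.
elim: l k => // u l IH [|k] hk; first by case: (b).
by rewrite mulnS /= IH.
Qed.

Lemma le_natr_rat (r : rat) k : (0 <= r)%R ->
  (r <= k%:R)%R = (`|numq r|%N <= k * `|denq r|%N).
Proof.
move=> r0; rewrite -{1}(divq_num_den r) ler_pdivrMr; last first.
  by rewrite ltr0z denq_gt0.
rewrite -[(k%:R)%R]/((k%:Z)%:~R)%R -intrM ler_int -(absz_denq r).
by rewrite -{1}(gez0_abs (_ : (0 <= numq r)%R)) ?numq_ge0.
Qed.

Lemma has_iota_ord n (P : pred nat) : has P (iota 0 n) = [exists u : 'I_n, P u].
Proof.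
rewrite -val_enum_ord has_map; apply/hasP/existsP => [[u _ hu]|[u hu]]; exists u => //.
by rewrite mem_enum.
Qed.

Lemma count_iota_ord n (P : pred nat) :
  count P (iota 0 n) = #|[set u : 'I_n | P u]|.
Proof.
rewrite -val_enum_ord count_map -sum1_count big_enum_cond -sum1dep_card.
exact: eq_bigl.
Qed.

Lemma sum_bool_card (T : finType) (P : pred T) : \sum_v (P v : nat) = #|[set v | P v]|.
Proof. by rewrite -sum1dep_card [RHS]big_mkcond; apply: eq_bigr => v _; case: (P v). Qed.

(** The interface between the layout of the input and the combinatorics: correctness uses nothing
    else about the tokens. *)
Record describes n (t : seq (seq bool)) (g : influence_game 'I_n) (i : 'I_n) : Prop := {
  describes_order : order t = n;
  describes_arc : forall u v : 'I_n, arc t u v = edge g u v;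
  describes_label : forall k (v : 'I_n), label_le t k v = (label g v <= k%:R)%R;
  describes_quota : quota_of t = quota g;
  describes_player : forall v : 'I_n, player t v = (v \in players g);
  describes_actor : actor_of t = i }.

Lemma enc_predE n (B : pred 'I_n) :
  enc_pred B = [seq Some b | b <- [seq B j | j <- enum 'I_n]].
Proof. by rewrite -map_comp. Qed.

Lemma tokens_instance (x : sat_instance) :
  describes (tokens (enc_instance x)) (game x) (actor x).
Proof.
case: x => n g i /=; set t := tokens _.
pose rows := [seq [seq edge g u v | v <- enum 'I_n] | u <- enum 'I_n].
pose labels := flatten [seq [:: nat_bits `|numq (label g u)|%N;
  nat_bits `|denq (label g u)|%N] | u <- enum 'I_n].
pose rest := [:: nat_bits (quota g); [seq v \in players g | v <- enum 'I_n];
  nat_bits i].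
have et : t = rows ++ labels ++ rest.
  rewrite /t /enc_instance; cbn [game actor nvertices].
  rewrite (@tokens_flatten _ _ (fun u => [:: [seq edge g u v | v <- enum 'I_n]])).
    rewrite (@tokens_flatten _ _ (fun u => [:: nat_bits `|numq (label g u)|%N;
      nat_bits `|denq (label g u)|%N])).
      rewrite !enc_natE tokens_delimited -[delimited [seq _ | _ <- nat_bits i]]cats0.
      rewrite enc_predE !tokens_delimited.
      by rewrite flatten_map1.
    by move=> u w; rewrite /enc_rat !enc_natE -catA !tokens_delimited.
  by move=> u w; rewrite enc_predE tokens_delimited.
have sr : size rows = n by rewrite size_map size_enum_ord.
have sl : size labels = 2 * n.
  rewrite -[in RHS](size_enum_ord n) /labels.
  by elim: (enum _) => //= u l ->; rewrite mulnS.
(* The actor witnesses that the matrix has a first row, from which [order] is read. *)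
have n0 : 0 < n by apply: leq_ltn_trans (ltn_ord i).
have ho : order t = n.
  rewrite /order -nth0 et nth_cat sr n0 (nth_map i) ?size_enum_ord //.
  by rewrite size_map size_enum_ord.
have h3 k : nth [::] t (3 * n + k) = nth [::] rest k.
  by rewrite et !nth_cat sr sl; do 2![case: ltnP; first lia]; move=> _ _;
    congr nth; lia.
have hlab (v : 'I_n) b : nth [::] t (n + (2 * v + nat_of_bool b)) =
    nat_bits (if b then `|denq (label g v)|%N else `|numq (label g v)|%N).
  rewrite et nth_cat sr ltnNge leq_addr /= addKn nth_cat sl.
  have -> : 2 * v + b < 2 * n by have := ltn_ord v; case: b; lia.
  rewrite (nth_flatten_pairs _ i) ?size_enum_ord // nth_ord_enum.
  by case: b.
split=> //.
- move=> u v; rewrite /arc et nth_cat sr ltn_ord (nth_map i) ?size_enum_ord //.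
  by rewrite (nth_map i) ?size_enum_ord // !nth_ord_enum.
- move=> k v; rewrite /label_le ho leq_bitsP muln_bitsP le_natr_rat ?label_ge0 //.
  by have := hlab v false; have := hlab v true; rewrite addn0 addn1 addnS => -> ->;
    rewrite !nat_bitsP.
- rewrite /quota_of ho cappedP -[3 * n]addn0 h3 /= nat_bitsP.
  by apply/minn_idPl; have := quota_le g; rewrite card_ord.
- by move=> v; rewrite /player ho -addn1 h3 /= (nth_map i) ?size_enum_ord // nth_ord_enum.
by rewrite /actor_of ho cappedP -addn2 h3 /= nat_bitsP; apply/minn_idPl/ltnW/ltn_ord.
Qed.

(** * Counting profiles by their keys *)

Definition key n (w : nat -> nat) (x : {ffun 'I_n -> bool}) := \sum_v x v * w v.

Lemma prod_weights n (w : nat -> nat) :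
  (\prod_(v < n) (1 + 'X^(w v)) =
   \sum_(x : {ffun 'I_n -> bool}) 'X^(key w x) :> {poly nat})%R.
Proof.
rewrite (eq_bigr (fun v : 'I_n => \sum_(b : bool) 'X^(b * w v)%N)%R); last first.
  by move=> v _; rewrite big_bool mul1n mul0n addrC.
rewrite bigA_distr_bigA; apply: eq_bigr => x _.
by rewrite prodrXr.
Qed.

(** The table holds only the first [keys t] coefficients of each partial product. This loses
    nothing, as a coefficient of the next product depends only on coefficients of the same or
    smaller index. *)
Lemma tableP t k : k < keys t ->
  bval (nth [::] (table t) k) =
  \sum_(x : {ffun 'I_(order t) -> bool}) (k == key (weight t) x).
Proof.
move=> hk; transitivity (((\prod_(v < order t) (1 + 'X^(weight t v)))%R : {poly nat})`_k)%R.
  rewrite /table; elim: (order t) k hk => [|j IH] k hk.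
    rewrite big_ord0 coef1.
    by case: k hk => [|[|k]] _ /=; rewrite ?bval_cons bval_nil.
  rewrite iota_rcons foldl_rcons nth_mkseq // add_bitsP IH // big_ord_recr /=.
  rewrite mulrDr mulr1 coefD coefMXn; congr addn.
  by case: ltnP => h; rewrite ?bval_nil // IH //; apply: leq_ltn_trans hk; lia.
rewrite prod_weights coef_sum; apply: eq_bigr => x _.
by rewrite coefXn; case: (k == _).
Qed.

(** After exchanging the sums over keys and over profiles, each profile contributes at its own key
    only, and the bound on keys ensures that this key is visited. *)
Lemma totalP t n : order t = n ->
  (forall x : {ffun 'I_n -> bool}, key (weight t) x < keys t) ->
  bval (total t) =
  #|[set x : {ffun 'I_n -> bool} | favourable t (key (weight t) x)]|.
Proof.
move=> <- hkey.
have -> : bval (total t) =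
    \sum_(k < keys t) favourable t k * bval (nth [::] (table t) k).
  rewrite /total; elim: (keys t) => [|j IH]; first by rewrite big_ord0 bval_nil.
  rewrite iota_rcons foldl_rcons big_ord_recr /= -IH.
  by case: favourable; rewrite ?add_bitsP ?mul1n // mul0n addn0.
under eq_bigr => k _ do rewrite tableP // big_distrr /=.
rewrite exchange_big /= -sum_bool_card; apply: eq_bigr => x _.
rewrite (bigD1 (Ordinal (hkey x))) //= eqxx muln1 big1 ?addn0 // => k.
by rewrite -val_eqE /= => /negPf ->; rewrite muln0.
Qed.

Lemma mixed_radix B a b c d : a < B -> b < B -> c < B ->
  let k := a + B * b + B * B * c + B * B * B * d in
  [/\ k %% B = a, (k %/ B) %% B = b, (k %/ (B * B)) %% B = c
    & k %/ (B * B * B) = d].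
Proof.
move=> ha hb hc k.
have B0 : 0 < B by apply: leq_ltn_trans ha.
have hq x y : x < B -> (x + B * y) %/ B = y.
  by move=> hx; rewrite addnC mulnC divnMDl // divn_small // addn0.
have hr x y : x < B -> (x + B * y) %% B = x.
  by move=> hx; rewrite addnC mulnC modnMDl modn_small.
have -> : k = a + B * (b + B * (c + B * d)) by rewrite /k; lia.
by rewrite !divnMA !hq // !hr.
Qed.

(** * Reading the decision off the key *)

Section Correctness.
Variables (n : nat) (t : seq (seq bool)) (g : influence_game 'I_n) (i : 'I_n).
Hypothesis dt : describes t g i.

Lemma leafE (v : 'I_n) : leaf t v = is_leaf_player g v.
Proof.
case: dt => ho ha _ _ hp _; rewrite /leaf hp ho has_iota_ord; congr (_ && _).
by apply: eq_existsb => u; rewrite ha.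
Qed.

Lemma easyE (v : 'I_n) : easy t v = is_easy g v.
Proof.
case: dt => ho ha hl _ hp _; rewrite /easy leafE hl ho has_iota_ord.
by congr (_ && _ && _); apply: eq_existsb => u; rewrite ha.
Qed.

Lemma hubE (v : 'I_n) : hub t v = is_hub g v.
Proof.
case: dt => ho ha hl _ hp _; rewrite /hub hp ho has_iota_ord; congr (_ && _).
by apply: eq_existsb => u; rewrite ha hp.
Qed.

Lemma awakeE k : awake t k = is_awake g k.
Proof.
case: dt => ho ha hl _ hp _; rewrite /awake ho has_iota_ord.
by apply: eq_existsb => u; rewrite hl hubE.
Qed.

Lemma recruitsE : recruits t = #|[set v | is_recruit g v]|.
Proof.
case: dt => ho ha hl _ hp _; rewrite /recruits ho count_iota_ord.
by apply: eq_card => u; rewrite !inE /recruit easyE hp hubE hl.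
Qed.

Definition hard_leaves (x : {ffun 'I_n -> bool}) :=
  [set v | x v && is_leaf_player g v && ~~ is_easy g v].
Definition easy_leaves (x : {ffun 'I_n -> bool}) := [set v | x v && is_easy g v].
Definition isolated (x : {ffun 'I_n -> bool}) :=
  [set v | [&& x v, v \in players g & ~~ is_leaf_player g v]].

(** Compared vertex by vertex: an active player counts in exactly one of the three classes, a
    non-player in none, and the actor adds the top digit in either case. *)
Lemma keyE (x : {ffun 'I_n -> bool}) : key (weight t) x =
  #|hard_leaves x| + base t * #|easy_leaves x| + base t * base t * #|isolated x|
    + base t * base t * base t * x i.
Proof.
case: dt => ho ha hl _ hp hact.
have -> : (x i : nat) = \sum_v (x v && (v == i)).
  rewrite (bigD1 i) //= eqxx andbT big1 ?addn0 // => v /negPf ->.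
  by rewrite andbF.
rewrite /hard_leaves /easy_leaves /isolated -!sum_bool_card !big_distrr /= -!big_split /=.
apply: eq_bigr => v _; rewrite /weight hp leafE easyE hact val_eqE.
have : is_leaf_player g v -> v \in players g by case/andP.
have : is_easy g v -> is_leaf_player g v by case/andP=> /andP[].
case: (is_easy g v) => [h1|_].
  by rewrite h1 // => ->; rewrite //; case: (x v); case: (v == i) => /=; lia.
case: (is_leaf_player g v) => [->|_] //.
  by case: (x v); case: (v == i) => /=; lia.
by case: (v \in _); case: (x v); case: (v == i) => /=; lia.
Qed.

Lemma card_lt_base (A : {set 'I_n}) : #|A| < base t.
Proof.
by case: dt => ho *; rewrite /base ho ltnS; have := max_card (mem A); rewrite card_ord.
Qed.

Lemma key_lt (x : {ffun 'I_n -> bool}) : key (weight t) x < keys t.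
Proof.
have [_ _ _ e] := mixed_radix (x i) (card_lt_base (hard_leaves x))
  (card_lt_base (easy_leaves x)) (card_lt_base (isolated x)).
by rewrite /keys -ltn_divLR // keyE e; case: (x i).
Qed.

Lemma favourableE (x : {ffun 'I_n -> bool}) :
  positive_labels g -> star_influence_game g ->
  favourable t (key (weight t) x) = (oblivious_decision g x == x i).
Proof.
move=> pos [L [I [R [c [F [hstar hN]]]]]].
have [e1 e2 e3 e4] := mixed_radix (x i) (card_lt_base (hard_leaves x))
  (card_lt_base (easy_leaves x)) (card_lt_base (isolated x)).
rewrite /favourable keyE e1 e2 e3 e4 lt0b; congr (_ == _).
rewrite /oblivious_decision; set A := _ :&: players g.
have sA : A \subset players g by apply: subsetIr.
have le v : is_leaf_player g v -> v \in players g by case/andP.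
have el v : is_easy g v -> is_leaf_player g v by case/andP=> /andP[].
rewrite (spreadE hstar hN pos sA).
have card_sum (X : {set 'I_n}) : #|X| = \sum_v (v \in X).
  by rewrite sum_bool_card; apply: eq_card => v; rewrite inE.
have -> : #|A :&: [set v | is_leaf_player g v]| = #|hard_leaves x| + #|easy_leaves x|.
  rewrite !card_sum -big_split; apply: eq_bigr => v _; rewrite !inE /=.
  move: (le v) (el v); case: (x v); case: (is_leaf_player g v); case: (is_easy g v);
    case: (v \in _) => //= h1 h2; by [case: (h1 isT) | case: (h2 isT)].
case: dt => ho ha hl -> hp hact; rewrite awakeE; case: ifP => _; congr (_ <= _).
  (* The final set is the disjoint union of the active non-easy leaves, the active isolated players
     and the recruits, since no recruit is of the first two kinds; this is checked on indicators. *)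
  rewrite recruitsE !card_sum -!big_split; apply: eq_bigr => v _; rewrite !inE /=.
  rewrite /is_recruit; move: (le v) (el v).
  case: (x v); case: (is_leaf_player g v); case: (is_easy g v);
    case: (v \in _) => //= h1 h2; try by [case: (h1 isT) | case: (h2 isT)].
rewrite !card_sum -!big_split; apply: eq_bigr => v _; rewrite !inE /=.
move: (le v) (el v); case: (x v); case: (is_leaf_player g v); case: (is_easy g v);
  case: (v \in _) => //= h1 h2; by [case: (h1 isT) | case: (h2 isT)].
Qed.

End Correctness.

Theorem theorem5 :
  polytime_computable oblivious_star enc_instance enc_nat
    oblivious_satisfaction.
Proof.
apply: (polytime_of_ptime ptime_sat_digits) => x [pos star].
have dt := tokens_instance x; have ho := describes_order dt.
rewrite /sat_digits digitsP (totalP ho (key_lt dt)); congr nat_bits.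
by apply: eq_card => y; rewrite !inE (favourableE dt).
Qed.
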